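(* Let $\Sigma$ be a mixing shift of finite type on a finite alphabet $S$, and let $m$ be its unique measure of maximal entropy (the Parry measure). Then there exists a constant $C>0$ such that for every shift-invariant Borel probability measure $\mu$ on $\Sigma$, $$\bar{d}(\mu,m)\le C\sqrt{h_{\mathrm{top}}(\Sigma)-h(\mu)}.$$ Explicitly, if $T$ is the stochastic matrix of transition probabilities of the Markov measure $m$, $k\in\mathbb{N}$ is such that every entry of $T^k$ is positive, and $q>0$ is such that $(T^k)_{ab}\ge q$ for all $a,b\in S$, then this holds with $C=\dfrac{\sqrt{2}\,k^{3/2}}{q}$.
   Context: $\mathbb{N}=\{1,2,\dots\}$, $S$ is a finite set, $S^{\mathbb{N}}$ carries the product topology, and the shift is $\sigma(x)_n=x_{n+1}$. A shift of finite type (SFT) is a set $\Sigma=\{x\in S^{\mathbb{N}}: A(x_n,x_{n+1})=1 \text{ for all } n\in\mathbb{N}\}$ for a transition matrix $A:S\times S\to\{0,1\}$. It is mixing if some power $A^n$, $n\in\mathbb{N}$, has all entries positive. For a word $w\in S^n$, $[w]=\{x\in\Sigma: x_1\cdots x_n=w\}$; $\mathcal{L}_n=\{w\in S^n:[w]\ne\emptyset\}$; the topological entropy is $h_{\mathrm{top}}(\Sigma)=\lim_{n\to\infty}\frac1n\log\#\mathcal{L}_n$. For a shift-invariant Borel probability measure $\mu$ on $\Sigma$, the entropy is $h(\mu)=\lim_{n\to\infty}\frac1n\sum_{w\in S^n}-\mu([w])\log\mu([w])$ with $0\log 0=0$ (natural logarithm). A measure of maximal entropy (MME) is a shift-invariant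 Borel probability measure $m$ on $\Sigma$ with $h(m)=h_{\mathrm{top}}(\Sigma)$; a mixing SFT has exactly one. It is the Parry measure: let $\lambda>0$ be the Perron–Frobenius eigenvalue of $A$, with positive left and right eigenvectors $\ell,r$ normalized so that $\sum_a \ell_a r_a=1$; then $m$ is the Markov measure with initial (stationary) distribution $p_a=\ell_a r_a$ and stochastic matrix $T_{ab}=\frac{A_{ab}r_b}{\lambda r_a}$, i.e. $m([w])=p_{w_1}T_{w_1w_2}\cdots T_{w_{n-1}w_n}$ for $w\in S^n$. A joining of shift-invariant measures $\mu,\nu$ on $\Sigma$ is a Borel probability measure $\theta$ on $\Sigma\times\Sigma$, invariant under $\sigma\times\sigma$, whose first and second marginals are $\mu$ and $\nu$. Ornstein's $\bar d$-distance is $\bar d(\mu,\nu)=\inf_\theta \theta(\{(x,y)\in\Sigma^2: x_1\ne y_1\})$, the infimum taken over all joinings $\theta$ of $\mu$ and $\nu$. *)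

(* Defs.v *)
(* MathComp / MathComp-Analysis. *)
From HB Require Import structures.
From mathcomp Require Import all_boot all_order all_algebra.
From mathcomp Require Import all_classical all_reals all_analysis.

Set Implicit Arguments.
Unset Strict Implicit.
Unset Printing Implicit Defensive.

Import Order.TTheory GRing.Theory Num.Theory.
Import numFieldNormedType.Exports.

Local Open Scope classical_set_scope.
Local Open Scope ring_scope.

(* Borel measures on a topological space.  Measurable types of the library are
   pointed, hence the pointed topological space. *)
Notation borel X := (g_sigma_algebraType (@open X)).

(* S^N with the product of the discrete topologies.  Coordinates are numbered
   from 0: the coordinate written x_n with n in {1, 2, ...} is [x n.-1].  The
   letter s0 only serves as the base point required of measurable types. *)
Definition config (S : finType) (s0 : S) : Type :=
  prod_topology (fun _ : nat => discrete_topology S).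

Section full_shift.
Variables (S : finType) (s0 : S).

HB.instance Definition _ := Topological.copy (config s0)
  (prod_topology (fun _ : nat => discrete_topology S)).
HB.instance Definition _ := isPointed.Build (config s0) (fun _ => s0).

Local Notation config := (config s0).

Definition shift (x : config) : config := fun n => x n.+1.

Definition shift2 (z : config * config) : config * config :=
  (shift z.1, shift z.2).

Definition sft (A : rel S) : set config := [set x | forall n, A (x n) (x n.+1)].

Definition cylinder (A : rel S) (n : nat) (w : n.-tuple S) : set config :=
  [set x | sft A x /\ forall i : 'I_n, x i = tnth w i].

Definition language (A : rel S) (n : nat) : {set n.-tuple S} :=
  [set w | `[< cylinder A w !=set0 >]]%SET.

End full_shift.

Section matrices.
Variable S : finType.

(* [mxpow M k a b] is the entry (M^k)_{ab} of a matrix M indexed by S; rows and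
   columns are numbered by the enumeration of S. *)
Definition mxpow (K : pzSemiRingType) (M : S -> S -> K) (k : nat) (a b : S) : K :=
  ((\matrix_(i < #|S|, j < #|S|) M (enum_val i) (enum_val j)) ^+ k)
    (enum_rank a) (enum_rank b).

Definition mixing (A : rel S) : Prop :=
  exists2 n : nat, (0 < n)%N &
    forall a b, (0 < mxpow (fun a b => nat_of_bool (A a b)) n a b)%N.

(* A positive eigenvector determines the eigenvalue: lambda is then the
   Perron-Frobenius eigenvalue. *)
Definition perron_data (R : realType) (A : rel S) (lambda : R) (l r : S -> R) :
    Prop :=
  [/\ 0 < lambda,
      (forall a, 0 < l a) /\ (forall a, 0 < r a),
      (forall b, \sum_a l a * (A a b)%:R = lambda * l b),
      (forall a, \sum_b (A a b)%:R * r b = lambda * r a) &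
      \sum_a l a * r a = 1].

(* Transition probabilities of the Parry measure. *)
Definition parry_matrix (R : realType) (A : rel S) (lambda : R) (r : S -> R)
    (a b : S) : R :=
  (A a b)%:R * r b / (lambda * r a).

End matrices.

Section entropy_and_dbar.
Variables (R : realType) (S : finType) (s0 : S) (A : rel S).
Local Notation X := (config s0).

(* Measures on the closed set [sft A] are represented by the measures on S^N
   that give it full mass. *)
Definition invariant_on_sft (mu : probability (borel X) R) : Prop :=
  mu (sft A) = 1%E /\
  forall B : set (borel X), measurable B -> mu (@shift S s0 @^-1` B) = mu B.

(* In the two sequences below, the term n = 0 is immaterial. *)
Definition htop : R :=
  limn (fun n : nat => n%:R^-1 * ln (#|language s0 A n|%:R : R)).

(* [ln 0 = 0], so that 0 log 0 = 0. *)
Definition entropy (mu : probability (borel X) R) : R :=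
  limn (fun n : nat => n%:R^-1 * \sum_(w : n.-tuple S)
    - (fine (mu (cylinder A w)) * ln (fine (mu (cylinder A w))))).

Definition is_mme (m : probability (borel X) R) : Prop :=
  invariant_on_sft m /\ entropy m = htop.

Definition joining (mu nu : probability (borel X) R)
    (theta : probability (borel (X * X)%type) R) : Prop :=
  [/\ theta (sft A `*` sft A) = 1%E,
      forall B : set (borel (X * X)%type), measurable B ->
        theta (@shift2 S s0 @^-1` B) = theta B,
      forall B : set (borel X), measurable B -> theta (fst @^-1` B) = mu B &
      forall B : set (borel X), measurable B -> theta (snd @^-1` B) = nu B].

Definition dbar (mu nu : probability (borel X) R) : \bar R :=
  ereal_inf [set theta [set z : X * X | [/\ sft A z.1, sft A z.2 &
                                           z.1 0%N <> z.2 0%N]]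
            | theta in joining mu nu].

End entropy_and_dbar.

(* Main.v *)
(* Write Delta = htop - h(mu), let r be a positive right eigenvector of A with
   eigenvalue lambda, and T the Parry matrix.  Since the logarithms of r telescope,
   the relative entropy of mu(x_n | x_0 ... x_(n-1)) with respect to
   T(x_(n-1), .), averaged over mu, is ln lambda - (H_(n+1) - H_n), which is at
   most Delta because conditional entropies decrease to h(mu) and
   htop = ln lambda.  By Pinsker's inequality the expected total variation
   distance of these two laws is at most sqrt Delta.  In particular a measure of
   maximal entropy, for which Delta = 0, is Markov with transition matrix T.

   Couple mu and m letter by letter: as long as the last letters differ the two
   processes move independently, and once they agree the next letters are
   coupled optimally.  Whatever the conditional laws of mu are, independent
   motion makes the two processes agree after k steps with probability at least
   q, while agreement is destroyed at each step with probability at most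
   sqrt Delta.  Hence the probability e_n of a mismatch at time n satisfies
   e_(n+k) <= (1 - q) e_n + k sqrt Delta, so its Cesaro means are asymptotically
   at most (k / q) sqrt Delta.  An ultralimit of the Cesaro means of the shifted
   coupling is a joining with this mismatch probability. *)
Require Import Defs.
From HB Require Import structures.
From mathcomp Require Import all_boot all_order all_algebra.
From mathcomp Require Import all_classical all_reals all_analysis.
From mathcomp Require Import lra ring.

Set Implicit Arguments.
Unset Strict Implicit.
Unset Printing Implicit Defensive.

Import Order.TTheory GRing.Theory Num.Theory.
Import numFieldNormedType.Exports.

Local Open Scope classical_set_scope.
Local Open Scope ring_scope.

(** * Finite sums and inequalities *)

Section word_sums.
Variables (V : nmodType) (T : finType).
Implicit Type g : seq T -> V.

Lemma sum_tuple0 g : \sum_(w : 0.-tuple T) g w = g [::].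
Proof.
by apply: (big_pred1 [tuple]) => w /=; apply/esym/eqP; exact: tuple0.
Qed.

Lemma sum_tuple_cons n g :
  \sum_(w : n.+1.-tuple T) g w = \sum_a \sum_(w : n.-tuple T) g (a :: w).
Proof.
rewrite pair_big /= (reindex (fun p : T * n.-tuple T => [tuple of p.1 :: p.2])) //=.
exists (fun w => (thead w, [tuple of behead w])) => [[a w] _|w _] /=.
  by congr pair; apply/val_inj.
by rewrite -tuple_eta.
Qed.

Lemma sum_tuple_rcons n g :
  \sum_(w : n.+1.-tuple T) g w = \sum_(w : n.-tuple T) \sum_a g (rcons w a).
Proof.
elim: n g => [|n IHn] g.
  by rewrite sum_tuple_cons (sum_tuple0 (fun w => \sum_a g (rcons w a)));
     apply: eq_bigr => a _; rewrite (sum_tuple0 (fun w => g (a :: w))).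
rewrite sum_tuple_cons (sum_tuple_cons _ (fun w => \sum_a g (rcons w a))).
by apply: eq_bigr => a _; rewrite (IHn (fun w => g (a :: w))).
Qed.

Lemma sum_tuple_cat m n g :
  \sum_(w : (m + n).-tuple T) g w =
  \sum_(u : m.-tuple T) \sum_(v : n.-tuple T) g (u ++ v).
Proof.
elim: m g => [|m IHm] g; first by rewrite (sum_tuple0 (fun u => \sum_(v : n.-tuple T) g (u ++ v))).
rewrite sum_tuple_cons (sum_tuple_cons _ (fun u => \sum_(v : n.-tuple T) g (u ++ v))).
by apply: eq_bigr => a _; rewrite (IHm (fun w => g (a :: w))).
Qed.

End word_sums.

Lemma sum_pair (V : nmodType) (I J : finType) (F : I * J -> V) :
  \sum_p F p = \sum_i \sum_j F (i, j).
Proof. by rewrite pair_bigA; apply: eq_bigr => -[]. Qed.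

Lemma sum_tuple_pred1 (R : pzSemiRingType) (T : finType) n w (h : seq T -> R) :
  size w = n -> \sum_(u : n.-tuple T) h u * (tval u == w)%:R = h w.
Proof.
move=> wn; have wP : size w == n by rewrite wn.
rewrite (bigD1 (Tuple wP))//= eqxx mulr1 big1 ?addr0// => u.
by rewrite -val_eqE /= => /negbTE ->; rewrite mulr0.
Qed.

Lemma ln_le_subr1 (R : realType) (x : R) : 0 < x -> ln x <= x - 1.
Proof.
move=> x0; rewrite -{1}[x](subrK 1) addrC; apply: le_ln1Dx.
by rewrite ltrBrDr addNr.
Qed.

Section finite_inequalities.
Variables (R : realType) (I : finType).
Implicit Types x y P Q : I -> R.

(** Cauchy-Schwarz from Lagrange's identity: the double sum of [(x i * y j - x j * y i) ^+ 2] is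
    twice the difference of the two sides. *)
Lemma sqr_sum_le x y :
  (\sum_i x i * y i) ^+ 2 <= (\sum_i x i ^+ 2) * (\sum_i y i ^+ 2).
Proof.
have H : 0 <= \sum_i \sum_j (x i * y j - x j * y i) ^+ 2.
  by apply: sumr_ge0 => i _; apply: sumr_ge0 => j _; exact: sqr_ge0.
have E : \sum_i \sum_j (x i * y j - x j * y i) ^+ 2 =
    (\sum_i x i ^+ 2) * (\sum_i y i ^+ 2) *+ 2 - (\sum_i x i * y i) ^+ 2 *+ 2.
  transitivity (\sum_i \sum_j (x i ^+ 2 * y j ^+ 2) +
     \sum_i \sum_j (x j ^+ 2 * y i ^+ 2) -
     (\sum_i \sum_j (x i * y i) * (x j * y j)) *+ 2).
    rewrite -big_split -sumrMnl -sumrB /=; apply: eq_bigr => i _.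
    rewrite -big_split -sumrMnl -sumrB /=; apply: eq_bigr => j _.
    ring.
  have -> : \sum_i \sum_j (x j ^+ 2 * y i ^+ 2) = \sum_i \sum_j (x i ^+ 2 * y j ^+ 2).
    by rewrite exchange_big.
  rewrite -mulr2n.
  have dist (u v : I -> R) : \sum_i \sum_j u i * v j = (\sum_i u i) * (\sum_i v i).
    by rewrite mulr_suml; apply: eq_bigr => i _; rewrite mulr_sumr.
  by rewrite (dist (fun i => x i ^+ 2) (fun i => y i ^+ 2))
             (dist (fun i => x i * y i) (fun i => x i * y i)) expr2.
by move: H; rewrite E subr_ge0 lerMn2r.
Qed.

(** Cauchy-Schwarz for the vectors [sqrt P] and [sqrt P * x]. *)
Lemma sqr_mean_le P x : (forall i, 0 <= P i) -> \sum_i P i = 1 ->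
  (\sum_i P i * x i) ^+ 2 <= \sum_i P i * x i ^+ 2.
Proof.
move=> P0 P1.
have := sqr_sum_le (fun i => Num.sqrt (P i)) (fun i => Num.sqrt (P i) * x i).
under eq_bigr do rewrite mulrA -expr2 sqr_sqrtr//.
under [X in _ <= X * _]eq_bigr do rewrite sqr_sqrtr//.
under [X in _ <= _ * X]eq_bigr do rewrite exprMn sqr_sqrtr//.
by rewrite P1 mul1r.
Qed.

(* Half the l^1 distance of P and Q when they are probability vectors. *)
Definition tv P Q : R := 1 - \sum_i Num.min (P i) (Q i).

Lemma tv_ge0 P Q : \sum_i P i = 1 -> 0 <= tv P Q.
Proof.
move=> P1; rewrite /tv subr_ge0 -[leRHS]P1.
by apply: ler_sum => i _; rewrite ge_min lexx.
Qed.

Lemma tv_le1 P Q : (forall i, 0 <= P i) -> (forall i, 0 <= Q i) -> tv P Q <= 1.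
Proof.
move=> P0 Q0; rewrite /tv gerBl; apply: sumr_ge0 => i _.
by rewrite le_min P0 Q0.
Qed.

(* The constant is twice the optimal one; it comes from comparing the relative
   entropy with the Hellinger distance. *)
Lemma pinsker P Q : (forall i, 0 <= P i) -> (forall i, 0 <= Q i) ->
  \sum_i P i = 1 -> \sum_i Q i = 1 -> (forall i, 0 < P i -> 0 < Q i) ->
  tv P Q ^+ 2 <= \sum_i P i * (ln (P i) - ln (Q i)).
Proof.
move=> P0 Q0 P1 Q1 PQ; set t := tv P Q.
have t0 : 0 <= t by exact: tv_ge0.
have t1 : t <= 1 by exact: tv_le1.
set B := \sum_i Num.sqrt (P i) * Num.sqrt (Q i).
have B0 : 0 <= B by apply: sumr_ge0 => i _; rewrite mulr_ge0 ?sqrtr_ge0.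
(* [B] is the Bhattacharyya coefficient; the bound is [ln x <= x - 1] at [x = sqrt (Q i / P i)],
   summed with weights [2 * P i]. *)
have DB : 2 - 2 * B <= \sum_i P i * (ln (P i) - ln (Q i)).
  have -> : 2 - 2 * B = \sum_i (2 * P i - 2 * (Num.sqrt (P i) * Num.sqrt (Q i))).
    by rewrite sumrB -!mulr_sumr P1 mulr1.
  apply: ler_sum => i _.
  have [Pi0|Pi0] := eqVneq (P i) 0; first by rewrite Pi0 sqrtr0 !(mul0r,mulr0) subr0.
  have Pi : 0 < P i by rewrite lt_neqAle eq_sym Pi0 P0.
  have Qi := PQ _ Pi.
  set a := Num.sqrt (P i); set b := Num.sqrt (Q i).
  have a0 : 0 < a by rewrite sqrtr_gt0.
  have b0 : 0 < b by rewrite sqrtr_gt0.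
  have -> : P i = a ^+ 2 by rewrite sqr_sqrtr.
  have -> : Q i = b ^+ 2 by rewrite sqr_sqrtr.
  rewrite !lnXn// -mulrnBl.
  have := ln_le_subr1 (divr_gt0 b0 a0); rewrite ln_div ?posrE//.
  set la := ln a; set lb := ln b => h.
  have : a ^+ 2 * (lb - la) <= a ^+ 2 * (b / a - 1) by rewrite ler_pM2l// exprn_gt0.
  have -> : a ^+ 2 * (b / a - 1) = a * b - a ^+ 2 by field; rewrite gt_eqF.
  nra.
suff : t ^+ 2 <= 2 - 2 * B by move/le_trans; apply.
(* The product of [P i] and [Q i] is that of their minimum and maximum, so Cauchy-Schwarz bounds
   [B ^+ 2] by the sum of minima, [1 - t], times the sum of maxima, [1 + t]. *)
have B2 : B ^+ 2 <= 1 - t ^+ 2.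
  have Emin : \sum_i Num.min (P i) (Q i) = 1 - t by rewrite /t /tv opprB addrC subrK.
  have Emax : \sum_i Num.max (P i) (Q i) = 1 + t.
    have -> : \sum_i Num.max (P i) (Q i) = \sum_i (P i + Q i - Num.min (P i) (Q i)).
      by apply: eq_bigr => i _; rewrite -(addr_max_min (P i)) addrK.
    rewrite sumrB big_split /= P1 Q1 Emin; ring.
  have -> : 1 - t ^+ 2 = (1 - t) * (1 + t) by ring.
  rewrite -Emin -Emax.
  have := sqr_sum_le (fun i => Num.sqrt (Num.min (P i) (Q i)))
    (fun i => Num.sqrt (Num.max (P i) (Q i))).
  have -> : \sum_i Num.sqrt (Num.min (P i) (Q i)) * Num.sqrt (Num.max (P i) (Q i)) = B.
    apply: eq_bigr => i _; rewrite -!sqrtrM ?le_min ?P0 ?Q0//.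
    by congr Num.sqrt; case: leP => _ //; rewrite mulrC.
  by under [X in _ <= X * _]eq_bigr do rewrite sqr_sqrtr ?le_min ?P0 ?Q0//;
     under [X in _ <= _ * X]eq_bigr do rewrite sqr_sqrtr ?le_max ?P0//.
have : B ^+ 2 <= (1 - t ^+ 2 / 2) ^+ 2 by nra.
by rewrite ler_pXn2r ?nnegrE//; nra.
Qed.

End finite_inequalities.

(** * Laws on words and their entropy *)

Section word_processes.
Variables (R : realType) (S : finType).
Implicit Types (f : seq S -> R) (u w : seq S).

(* [f w] is the probability that a process starts with the word w. *)
Record word_law f : Prop := WordLaw {
  word_law_ge0 : forall w, 0 <= f w;
  word_law_nil : f [::] = 1;
  word_law_rcons : forall w, \sum_a f (rcons w a) = f w }.

Definition stationary f := forall w, \sum_a f (a :: w) = f w.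

Lemma sum_word_law f n : word_law f -> \sum_(w : n.-tuple S) f w = 1.
Proof.
move=> lf; elim: n => [|n IHn]; first by rewrite sum_tuple0 word_law_nil.
by rewrite sum_tuple_rcons; under eq_bigr do rewrite word_law_rcons//.
Qed.

Lemma le_word_law f u a : word_law f -> f (rcons u a) <= f u.
Proof.
move=> lf; rewrite -(word_law_rcons lf u) (bigD1 a)//= lerDl.
by apply: sumr_ge0 => b _; exact: word_law_ge0.
Qed.

Lemma word_law_rcons_eq0 f u a : word_law f -> f u = 0 -> f (rcons u a) = 0.
Proof.
move=> lf fu; apply/eqP; rewrite eq_le (word_law_ge0 lf) andbT -fu.
exact: le_word_law.
Qed.

Lemma word_law_le1 f u : word_law f -> f u <= 1.
Proof.
move=> lf; elim/last_ind: u => [|u a IHu]; first by rewrite word_law_nil.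
exact: le_trans (le_word_law _ _ lf) IHu.
Qed.

Lemma stationary_cat f n w : stationary f ->
  \sum_(u : n.-tuple S) f (u ++ w) = f w.
Proof.
move=> sf; elim: n w => [|n IHn] w.
  exact: (sum_tuple0 (fun u => f (u ++ w))).
rewrite (sum_tuple_rcons _ (fun u => f (u ++ w))) exchange_big /=.
under eq_bigr do under eq_bigr do rewrite cat_rcons.
by under eq_bigr do rewrite IHn.
Qed.

(** By stationarity the last letter has the same law as the first. *)
Lemma sum_last f n s0 (phi : S -> R) : word_law f -> stationary f ->
  \sum_(u : n.+1.-tuple S) f u * phi (last s0 u) = \sum_a f [:: a] * phi a.
Proof.
move=> lf sf; rewrite (sum_tuple_rcons _ (fun u => f u * phi (last s0 u))).
under eq_bigr do under eq_bigr do rewrite last_rcons.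
rewrite exchange_big /=; apply: eq_bigr => a _; rewrite -mulr_suml; congr (_ * _).
by rewrite -(stationary_cat n [:: a] sf); apply: eq_bigr => u _; rewrite cats1.
Qed.

Definition block_entropy f n : R := \sum_(w : n.-tuple S) - (f w * ln (f w)).

Lemma block_entropy0 f : word_law f -> block_entropy f 0 = 0.
Proof.
move=> lf; rewrite /block_entropy (sum_tuple0 (fun w => - (f w * ln (f w)))).
by rewrite word_law_nil// ln1 mulr0 oppr0.
Qed.

Definition cond_entropy f n : R := block_entropy f n.+1 - block_entropy f n.

Lemma cond_entropyE f n : word_law f -> cond_entropy f n =
  \sum_(u : n.-tuple S) \sum_a f (rcons u a) * (ln (f u) - ln (f (rcons u a))).
Proof.
move=> lf; rewrite /cond_entropy /block_entropy.
rewrite (sum_tuple_rcons _ (fun w => - (f w * ln (f w)))) -sumrB.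
apply: eq_bigr => u _.
under [RHS]eq_bigr do rewrite mulrBr.
by rewrite sumrB -mulr_suml (word_law_rcons lf) opprK sumrN addrC.
Qed.

Lemma cond_entropy_ge0 f n : word_law f -> 0 <= cond_entropy f n.
Proof.
move=> lf; rewrite cond_entropyE//; apply: sumr_ge0 => u _; apply: sumr_ge0 => a _.
have := word_law_ge0 lf (rcons u a); rewrite le_eqVlt => /predU1P[<-|fua].
  by rewrite mul0r.
rewrite mulr_ge0 ?(ltW fua)// subr_ge0 ler_ln ?posrE//; first exact: le_word_law.
exact: lt_le_trans fua (le_word_law _ _ lf).
Qed.

(* Log-sum inequality. *)
Lemma cond_entropy_le f n : word_law f -> stationary f ->
  cond_entropy f n.+1 <= cond_entropy f n.
Proof.
move=> lf sf; rewrite !cond_entropyE//.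
rewrite (sum_tuple_cons _ (fun u => \sum_a f (rcons u a) * (ln (f u) - ln (f (rcons u a))))).
rewrite exchange_big /=; apply: ler_sum => u _.
rewrite exchange_big /= -subr_ge0.
have -> : \sum_a f (rcons u a) * (ln (f u) - ln (f (rcons u a))) =
   \sum_a \sum_s f (s :: rcons u a) * (ln (f u) - ln (f (rcons u a))).
  by apply: eq_bigr => a _; rewrite -mulr_suml sf.
rewrite -sumrB; under eq_bigr do rewrite -sumrB.
(* The subtracted term is the law under which s and a are independent given u. The sum of [g] over s
   and a is 0, so it suffices to bound each term below by [g s a], which is [ln x <= x - 1]
   again. *)
pose g s a := f (s :: rcons u a) - f (rcons u a) * f (s :: u) / f u.
apply: (@le_trans _ _ (\sum_a \sum_s g s a)).
  rewrite /g; under eq_bigr do rewrite sumrB sf -mulr_suml -mulr_sumr sf.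
  rewrite sumrB (word_law_rcons lf) -!mulr_suml (word_law_rcons lf).
  have [->|fu] := eqVneq (f u) 0; first by rewrite !mul0r subrr.
  by rewrite mulfK// subrr.
apply: ler_sum => a _; apply: ler_sum => s _; rewrite /g.
have := word_law_ge0 lf (s :: rcons u a); rewrite le_eqVlt => /predU1P[<-|fsua].
  by rewrite !mul0r subrr sub0r oppr_le0 mulr_ge0 ?invr_ge0 ?mulr_ge0 ?(word_law_ge0 lf).
have fsu : 0 < f (s :: u) by rewrite (lt_le_trans fsua)// -rcons_cons le_word_law.
have le_cons w : f (s :: w) <= f w.
  rewrite -(sf w) (bigD1 s)//= lerDl; apply: sumr_ge0 => b _.
  exact: word_law_ge0.
have fu : 0 < f u by rewrite (lt_le_trans fsu).
have fua : 0 < f (rcons u a) by rewrite (lt_le_trans fsua).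
have h : 0 < f (rcons u a) * f (s :: u) / (f u * f (s :: rcons u a)).
  by rewrite divr_gt0 ?mulr_gt0.
have := ln_le_subr1 h.
rewrite ln_div ?posrE ?mulr_gt0// !lnM ?posrE//.
move=> /(ler_wpM2l (ltW fsua)).
have -> : f (s :: rcons u a) *
    (f (rcons u a) * f (s :: u) / (f u * f (s :: rcons u a)) - 1) =
   f (rcons u a) * f (s :: u) / f u - f (s :: rcons u a).
  by field; rewrite !gt_eqF.
lra.
Qed.

(** Block entropies are partial sums of the conditional entropies, which decrease and are
    nonnegative; by Cesaro's theorem the entropy rate is their limit, hence below each of them. *)
Lemma limn_block_entropy_le f n : word_law f -> stationary f ->
  limn (fun n => n%:R^-1 * block_entropy f n) <= cond_entropy f n.
Proof.
move=> lf sf.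
have dc : nonincreasing_seq (cond_entropy f).
  by apply/nonincreasing_seqP => k; exact: cond_entropy_le.
have lb : has_lbound (range (cond_entropy f)).
  by exists 0 => _ [k _ <-]; exact: cond_entropy_ge0.
have cc := nonincreasing_is_cvgn dc lb.
rewrite (_ : limn _ = limn (cond_entropy f)); first exact: nonincreasing_cvgn_ge.
apply: cvg_lim => //; rewrite -cvg_shiftS /=.
suff <- : arithmetic_mean (cond_entropy f) =
    fun k => k.+1%:R^-1 * block_entropy f k.+1 by exact: cesaro cc.
apply/funext => k; rewrite /arithmetic_mean /series /= telescope_sumr//.
by rewrite block_entropy0// subr0.
Qed.

End word_processes.

Section transition_matrix.
Variables (R : realType) (S : finType) (A : rel S) (lambda : R) (r : S -> R).
Hypotheses (lambda0 : 0 < lambda) (r0 : forall a, 0 < r a).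
Hypothesis rE : forall a, \sum_b (A a b)%:R * r b = lambda * r a.
Local Notation T := (parry_matrix A lambda r).

Lemma parry_matrix_ge0 a b : 0 <= T a b.
Proof.
by rewrite divr_ge0 ?mulr_ge0 ?ler0n//; exact: ltW.
Qed.

Lemma parry_matrix_gt0 a b : A a b -> 0 < T a b.
Proof. by move=> Aab; rewrite /parry_matrix Aab mul1r divr_gt0 ?mulr_gt0. Qed.

Lemma sum_parry_matrix a : \sum_b T a b = 1.
Proof. by rewrite -mulr_suml rE divff// gt_eqF ?mulr_gt0. Qed.

End transition_matrix.

Section conditional_laws.
Variables (R : realType) (S : finType) (s0 : S) (T : S -> S -> R).
Hypotheses (T0 : forall a b, 0 <= T a b) (T1 : forall a, \sum_b T a b = 1).
Variable f : seq S -> R.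
Hypothesis lf : word_law f.

(* On words of probability 0 the value is immaterial, as long as it is a
   probability vector. *)
Definition cond_law u a : R :=
  if f u == 0 then T (last s0 u) a else f (rcons u a) / f u.

Lemma cond_law_ge0 u a : 0 <= cond_law u a.
Proof.
by rewrite /cond_law; case: ifP => // _; rewrite divr_ge0 ?(word_law_ge0 lf).
Qed.

Lemma sum_cond_law u : \sum_a cond_law u a = 1.
Proof.
rewrite /cond_law; case: eqVneq => [_|fu]; first exact: T1.
by rewrite -mulr_suml (word_law_rcons lf) divff.
Qed.

Lemma mul_cond_law u a : f u * cond_law u a = f (rcons u a).
Proof.
rewrite /cond_law; case: eqVneq => [fu|fu]; last by rewrite mulrC mulfVK.
by rewrite fu mul0r word_law_rcons_eq0.
Qed.

End conditional_laws.

(** * Relative entropy with respect to the Parry transitions *)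

Section relative_entropy.
Variables (R : realType) (S : finType) (s0 : S) (A : rel S) (lambda : R).
Variable r : S -> R.
Hypotheses (lambda0 : 0 < lambda) (r0 : forall a, 0 < r a).
Hypothesis rE : forall a, \sum_b (A a b)%:R * r b = lambda * r a.
Local Notation T := (parry_matrix A lambda r).
Variable f : seq S -> R.
Hypotheses (lf : word_law f) (sf : stationary f).
Hypothesis admf :
  forall u a, u != [::] -> 0 < f (rcons u a) -> A (last s0 u) a.

Definition tv_step u : R := tv (cond_law s0 T f u) (T (last s0 u)).

Lemma tv_step_ge0 u : 0 <= tv_step u.
Proof.
by apply: tv_ge0; apply: sum_cond_law => //; exact: sum_parry_matrix.
Qed.

(* The logarithms of r telescope by stationarity. *)
Lemma sum_tv_step_sqr_le n :
  \sum_(u : n.+1.-tuple S) f u * tv_step u ^+ 2 <= ln lambda - cond_entropy f n.+1.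
Proof.
have T0 := parry_matrix_ge0 A lambda0 r0.
have T1 := sum_parry_matrix lambda0 r0 rE.
(* The integrand of the relative entropy, with [- ln (T b a)] expanded as
   [ln lambda + ln (r b) - ln (r a)], which is valid when [A b a] holds. *)
pose h u a : R := f (rcons u a) * (ln (f (rcons u a)) - ln (f u)) +
  f (rcons u a) * (ln lambda + ln (r (last s0 u)) - ln (r a)).
apply: (@le_trans _ _ (\sum_(u : n.+1.-tuple S) \sum_a h u a)).
  apply: ler_sum => u _.
  have u0 : tval u != [::] by rewrite -size_eq0 size_tuple.
  have [fu|fu] := eqVneq (f u) 0.
    rewrite fu mul0r; apply: sumr_ge0 => a _.
    by rewrite /h (word_law_rcons_eq0 _ lf fu) !mul0r addr0.
  have fu_gt0 : 0 < f u by rewrite lt_neqAle eq_sym fu word_law_ge0.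
  apply: (@le_trans _ _ (f u * \sum_a cond_law s0 T f u a *
      (ln (cond_law s0 T f u a) - ln (T (last s0 u) a)))).
    rewrite ler_pM2l//; apply: pinsker => //.
    - exact: cond_law_ge0.
    - exact: sum_cond_law.
    - move=> a; rewrite -(pmulr_rgt0 _ fu_gt0) mul_cond_law// => fua.
      by apply: parry_matrix_gt0 => //; exact: admf.
  rewrite mulr_sumr le_eqVlt; apply/orP; left; apply/eqP; apply: eq_bigr => a _.
  rewrite mulrA mul_cond_law// /h.
  have := word_law_ge0 lf (rcons u a); rewrite le_eqVlt => /predU1P[<-|fua].
    by rewrite !mul0r addr0.
  have Aua := admf u0 fua.
  rewrite /cond_law (negbTE fu) /parry_matrix Aua mul1r.
  rewrite !ln_div ?posrE ?mulr_gt0// lnM ?posrE//.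
  ring.
rewrite /h; under eq_bigr do rewrite big_split /=.
rewrite big_split /= cond_entropyE// addrC lerD//; last first.
  rewrite -sumrN; apply: ler_sum => u _; rewrite -sumrN; apply: ler_sum => a _.
  by rewrite -mulrN opprB.
under eq_bigr do under eq_bigr do rewrite mulrBr.
under eq_bigr do rewrite sumrB.
rewrite sumrB.
under eq_bigr do rewrite -mulr_suml (word_law_rcons lf) mulrDr.
rewrite big_split /= -mulr_suml sum_word_law// mul1r.
rewrite (sum_last n s0 (fun b => ln (r b)))//.
have -> : \sum_(u : n.+1.-tuple S) \sum_a f (rcons u a) * ln (r a) =
    \sum_a f [:: a] * ln (r a).
  rewrite -(sum_last n.+1 s0 (fun b => ln (r b)) lf sf).
  rewrite (sum_tuple_rcons n.+1 (fun u => f u * ln (r (last s0 u)))).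
  by apply: eq_bigr => u _; apply: eq_bigr => a _; rewrite last_rcons.
by rewrite addrK.
Qed.

Lemma cond_entropy_le_ln n : cond_entropy f n.+1 <= ln lambda.
Proof.
rewrite -subr_ge0; apply: le_trans (sum_tv_step_sqr_le n).
by apply: sumr_ge0 => u _; rewrite mulr_ge0 ?sqr_ge0// word_law_ge0.
Qed.

(** Jensen's inequality applied to the mean square bound; [cond_entropy_le_ln] makes the radicand
    nonnegative. *)
Lemma mean_tv_step_le n :
  \sum_(u : n.+1.-tuple S) f u * tv_step u <=
  Num.sqrt (ln lambda - cond_entropy f n.+1).
Proof.
rewrite -(ler_pXn2r (ltn0Sn 1)) ?nnegrE ?sqrtr_ge0//; last first.
  by apply: sumr_ge0 => u _; rewrite mulr_ge0 ?tv_step_ge0// word_law_ge0.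
rewrite sqr_sqrtr ?subr_ge0 ?cond_entropy_le_ln//.
apply: le_trans (sum_tv_step_sqr_le n).
apply: (sqr_mean_le (P := fun u : n.+1.-tuple S => f u)) => [u|].
  exact: word_law_ge0.
exact: sum_word_law.
Qed.

(* Full entropy forces the relative entropies, hence all the total variation
   distances, to vanish. *)
Lemma full_entropy_markov : ln lambda <= limn (fun n => n%:R^-1 * block_entropy f n) ->
  forall u a, u != [::] -> f (rcons u a) = f u * T (last s0 u) a.
Proof.
move=> full u a u0.
have [fu|fu] := eqVneq (f u) 0.
  by rewrite fu mul0r word_law_rcons_eq0.
have T1 := sum_parry_matrix lambda0 r0 rE.
case: u u0 fu => // b u _ fu; set n := size u.
pose w := in_tuple (b :: u).
(* One term of a sum of nonnegative terms whose total is at most [ln lambda] minus a conditional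
   entropy; the latter is at least the entropy rate, hence at least [ln lambda]. *)
have : f w * tv_step w ^+ 2 <= 0.
  have h := limn_block_entropy_le n.+1 lf sf.
  apply: (@le_trans _ _ (ln lambda - cond_entropy f n.+1)); last first.
    by rewrite subr_le0; exact: le_trans full h.
  apply: le_trans (sum_tv_step_sqr_le n).
  rewrite (bigD1 (w : n.+1.-tuple S))//= lerDl; apply: sumr_ge0 => v _.
  by rewrite mulr_ge0 ?sqr_ge0// word_law_ge0.
rewrite pmulr_rle0; last by rewrite lt_neqAle eq_sym fu word_law_ge0.
move=> tv0; have {tv0} : tv_step w = 0.
  by apply/eqP; rewrite -sqrf_eq0 eq_le tv0 sqr_ge0.
rewrite -(mul_cond_law s0 T lf) => tv0; congr (_ * _).
set P := cond_law s0 T f (b :: u); set Q := T _.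
have P1 : \sum_a P a = 1 by exact: sum_cond_law.
have Q1 : \sum_a Q a = 1 by exact: T1.
have M1 : \sum_a Num.min (P a) (Q a) = 1 by move/eqP: tv0; rewrite subr_eq0 => /eqP.
(* Pointwise order with equal sums forces equality; used to identify the minimum of [P] and [Q] with
   each of them. *)
have le0 (F G : S -> R) : (forall i, F i <= G i) -> \sum_i F i = \sum_i G i -> F a = G a.
  move=> FG /eqP; rewrite eq_sym -subr_eq0 -sumrB psumr_eq0.
    by move=> /allP/(_ a (mem_index_enum a))/=; rewrite subr_eq0 => /eqP.
  by move=> i _; rewrite subr_ge0.
rewrite -(le0 (fun a => Num.min (P a) (Q a)) P); last 2 first.
- by move=> i; rewrite ge_min lexx.
- by rewrite M1 P1.
apply: (le0 (fun a => Num.min (P a) (Q a)) Q).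
- by move=> i; rewrite ge_min lexx orbT.
- by rewrite M1 Q1.
Qed.

End relative_entropy.

(** * Coupling *)

Section maximal_coupling.
Variables (R : realType) (S : finType) (P Q : S -> R).
Hypotheses (P0 : forall a, 0 <= P a) (Q0 : forall a, 0 <= Q a).
Hypotheses (P1 : \sum_a P a = 1) (Q1 : \sum_a Q a = 1).

(* If [tv P Q = 0] the second summand is 0, and so is the numerator. *)
Definition maximal_coupling a b : R :=
  (a == b)%:R * Num.min (P a) (Q a) +
  (P a - Num.min (P a) (Q a)) * (Q b - Num.min (P b) (Q b)) / tv P Q.

Let minP a : 0 <= P a - Num.min (P a) (Q a).
Proof. by rewrite subr_ge0 ge_min lexx. Qed.

Let minQ a : 0 <= Q a - Num.min (P a) (Q a).
Proof. by rewrite subr_ge0 ge_min lexx orbT. Qed.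

Lemma maximal_coupling_ge0 a b : 0 <= maximal_coupling a b.
Proof.
rewrite addr_ge0//; first by rewrite mulr_ge0 ?ler0n// le_min P0 Q0.
by rewrite divr_ge0 ?mulr_ge0// tv_ge0.
Qed.

Lemma sum_maximal_couplingl a : \sum_b maximal_coupling a b = P a.
Proof.
rewrite big_split /= (bigD1 a)//= eqxx mul1r big1 ?addr0; last first.
  by move=> b; rewrite eq_sym => /negbTE ->; rewrite mul0r.
rewrite -mulr_suml -mulr_sumr sumrB Q1 -/(tv P Q).
have [t0|t0] := eqVneq (tv P Q) 0; last by rewrite mulfK// addrC subrK.
rewrite t0 mulr0 mul0r addr0.
have : \sum_a (P a - Num.min (P a) (Q a)) = 0 by rewrite sumrB P1.
move/eqP; rewrite psumr_eq0// => /allP/(_ a (mem_index_enum a))/=.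
by rewrite subr_eq0 => /eqP.
Qed.

Lemma sum_maximal_couplingr b : \sum_a maximal_coupling a b = Q b.
Proof.
rewrite big_split /= (bigD1 b)//= eqxx mul1r big1 ?addr0; last first.
  by move=> a /negbTE ->; rewrite mul0r.
rewrite -mulr_suml -mulr_suml sumrB P1 -/(tv P Q).
have [t0|t0] := eqVneq (tv P Q) 0; last by rewrite mulrAC divff// mul1r addrC subrK.
rewrite t0 !mul0r addr0.
have : \sum_a (Q a - Num.min (P a) (Q a)) = 0 by rewrite sumrB Q1.
move/eqP; rewrite psumr_eq0// => /allP/(_ b (mem_index_enum b))/=.
by rewrite subr_eq0 => /eqP.
Qed.

(** Row a carries total mass [P a], and its diagonal entry is at least the minimum of [P a] and
    [Q a]. *)
Lemma maximal_coupling_neq_le :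
  \sum_a \sum_b maximal_coupling a b * (a != b)%:R <= tv P Q.
Proof.
have -> : tv P Q = \sum_a (P a - Num.min (P a) (Q a)) by rewrite sumrB P1.
apply: ler_sum => a _.
rewrite (bigD1 a)//= eqxx mulr0 add0r.
rewrite (eq_bigr (maximal_coupling a)); last first.
  by move=> b; rewrite eq_sym => ->; rewrite mulr1.
rewrite -[X in _ <= X - _]sum_maximal_couplingl [X in _ <= X - _](bigD1 a)//=.
rewrite addrAC lerDr subr_ge0 /maximal_coupling eqxx mul1r lerDl.
by rewrite divr_ge0 ?mulr_ge0// tv_ge0.
Qed.

End maximal_coupling.

Section matrix_powers.
Variables (S : finType) (K : pzSemiRingType) (M : S -> S -> K).

Lemma mxpow0 a b : mxpow M 0 a b = (a == b)%:R.
Proof. by rewrite /mxpow expr0 mxE (inj_eq enum_rank_inj). Qed.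

Lemma mxpowS k a b : mxpow M k.+1 a b = \sum_c M a c * mxpow M k c b.
Proof.
rewrite /mxpow exprS mxE (reindex enum_rank) /=; last first.
  by exists enum_val => ? _; [exact: enum_rankK | exact: enum_valK].
by apply: eq_bigr => c _; rewrite mxE !enum_rankK.
Qed.

End matrix_powers.

Section stochastic_powers.
Variables (R : realType) (S : finType) (T : S -> S -> R).
Hypotheses (T0 : forall a b, 0 <= T a b) (T1 : forall a, \sum_b T a b = 1).

Lemma mxpow_ge0 k a b : 0 <= mxpow T k a b.
Proof.
elim: k a => [|k IHk] a; first by rewrite mxpow0.
by rewrite mxpowS; apply: sumr_ge0 => c _; rewrite mulr_ge0.
Qed.

Lemma sum_mxpow k a : \sum_b mxpow T k a b = 1.
Proof.
elim: k a => [|k IHk] a.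
  rewrite (bigD1 a)//= mxpow0 eqxx big1 ?addr0// => b.
  by rewrite mxpow0 eq_sym => /negbTE ->.
under eq_bigr do rewrite mxpowS.
rewrite exchange_big /= -[RHS](T1 a); apply: eq_bigr => c _.
by rewrite -mulr_sumr IHk mulr1.
Qed.

Lemma mxpow_le1 k a b : mxpow T k a b <= 1.
Proof.
rewrite -(sum_mxpow k a) (bigD1 b)//= lerDl.
by apply: sumr_ge0 => c _; exact: mxpow_ge0.
Qed.

End stochastic_powers.

(** * The letter-by-letter coupling and its mismatch probability *)

Section coupled_process.
Variables (R : realType) (S : finType) (s0 : S) (T : S -> S -> R).
Hypotheses (T0 : forall a b, 0 <= T a b) (T1 : forall a, \sum_b T a b = 1).
Variables f g : seq S -> R.
Hypotheses (lf : word_law f) (lg : word_law g).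
Hypothesis gT : forall v b, v != [::] -> g (rcons v b) = g v * T (last s0 v) b.

Local Notation kf := (cond_law s0 T f).
Let f_step u : R := tv (kf u) (T (last s0 u)).

(** On the empty word [last] would return the default [s0], so the initial letter is drawn from [g]
    instead. *)
Definition markov_step v b : R := if v is [::] then g [:: b] else T (last s0 v) b.

Lemma markov_step_ge0 v b : 0 <= markov_step v b.
Proof. by case: v => //=; rewrite word_law_ge0. Qed.

Lemma sum_markov_step v : \sum_b markov_step v b = 1.
Proof.
case: v => //=; rewrite -[RHS](word_law_nil lg).
by rewrite -(word_law_rcons lg [::]).
Qed.

Lemma mul_markov_step v b : g v * markov_step v b = g (rcons v b).
Proof.
case: v => [|a v]; first by rewrite word_law_nil// mul1r.
by rewrite gT.
Qed.

(* While the last letters differ, the two processes move independently; once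
   they agree, the next letters are coupled optimally. *)
Definition coupling_step u v a b : R :=
  if last s0 u == last s0 v then maximal_coupling (kf u) (markov_step v) a b
  else kf u a * markov_step v b.

Lemma coupling_step_ge0 u v a b : 0 <= coupling_step u v a b.
Proof.
rewrite /coupling_step; case: ifP => _.
  apply: maximal_coupling_ge0 => *; rewrite ?cond_law_ge0 ?markov_step_ge0//.
  exact: sum_cond_law.
by rewrite mulr_ge0 ?cond_law_ge0 ?markov_step_ge0.
Qed.

Lemma sum_coupling_stepl u v a : \sum_b coupling_step u v a b = kf u a.
Proof.
rewrite /coupling_step; case: (_ == _); last first.
  by rewrite -mulr_sumr sum_markov_step mulr1.
by apply: sum_maximal_couplingl; [exact: sum_cond_law | exact: sum_markov_step].
Qed.

Lemma sum_coupling_stepr u v b : \sum_a coupling_step u v a b = markov_step v b.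
Proof.
rewrite /coupling_step; case: (_ == _); last first.
  by rewrite -mulr_suml sum_cond_law// mul1r.
by apply: sum_maximal_couplingr; [exact: sum_cond_law | exact: sum_markov_step].
Qed.

(** Words grow at their right end, whereas recursion peels letters from the left; hence the
    reversal. *)
Fixpoint rev_coupled (w : seq (S * S)) : R :=
  if w is p :: w' then
    rev_coupled w' *
    coupling_step (rev (unzip1 w')) (rev (unzip2 w')) p.1 p.2
  else 1.

Definition coupled w := rev_coupled (rev w).

Lemma coupled_rcons w p :
  coupled (rcons w p) = coupled w * coupling_step (unzip1 w) (unzip2 w) p.1 p.2.
Proof. by rewrite /coupled rev_rcons /= /unzip1 /unzip2 !map_rev !revK. Qed.

Lemma sum_coupling_step u v : \sum_p coupling_step u v p.1 p.2 = 1.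
Proof.
rewrite sum_pair /=.
under eq_bigr do rewrite sum_coupling_stepl.
exact: sum_cond_law.
Qed.

Lemma coupled_word_law : word_law coupled.
Proof.
split.
- elim/last_ind => [|w p IHw]; first by rewrite /coupled.
  by rewrite coupled_rcons mulr_ge0 ?coupling_step_ge0.
- by [].
- by move=> w; under eq_bigr do rewrite coupled_rcons; rewrite -mulr_sumr sum_coupling_step mulr1.
Qed.

(** Induction on the length: the first marginal of the coupling step is [kf u] whatever the past of
    the second process. *)
Lemma coupled_marginall n (phi : seq S -> R) :
  \sum_(w : n.-tuple (S * S)%type) coupled w * phi (unzip1 w) =
  \sum_(u : n.-tuple S) f u * phi u.
Proof.
elim: n phi => [|n IHn] phi.
  rewrite (sum_tuple0 (fun w : seq (S * S) => coupled w * phi (unzip1 w))).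
  rewrite (sum_tuple0 (fun u => f u * phi u)).
  by rewrite (word_law_nil coupled_word_law) (word_law_nil lf).
rewrite (sum_tuple_rcons n (fun w : seq (S * S) => coupled w * phi (unzip1 w))).
rewrite (sum_tuple_rcons n (fun u => f u * phi u)).
transitivity (\sum_(u : n.-tuple S) f u * \sum_a kf u a * phi (rcons u a)).
  rewrite -(IHn (fun u => \sum_a kf u a * phi (rcons u a))).
  apply: eq_bigr => w _; rewrite mulr_sumr.
  rewrite sum_pair /=.
  apply: eq_bigr => a _; rewrite mulrA -(sum_coupling_stepl _ (unzip2 w)) mulr_sumr mulr_suml.
  by apply: eq_bigr => b _; rewrite coupled_rcons /unzip1 map_rcons.
apply: eq_bigr => u _; rewrite mulr_sumr; apply: eq_bigr => a _.
by rewrite mulrA mul_cond_law.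
Qed.

Lemma coupled_marginalr n (phi : seq S -> R) :
  \sum_(w : n.-tuple (S * S)%type) coupled w * phi (unzip2 w) =
  \sum_(v : n.-tuple S) g v * phi v.
Proof.
elim: n phi => [|n IHn] phi.
  rewrite (sum_tuple0 (fun w : seq (S * S) => coupled w * phi (unzip2 w))).
  rewrite (sum_tuple0 (fun v => g v * phi v)).
  by rewrite (word_law_nil coupled_word_law) (word_law_nil lg).
rewrite (sum_tuple_rcons n (fun w : seq (S * S) => coupled w * phi (unzip2 w))).
rewrite (sum_tuple_rcons n (fun v => g v * phi v)).
transitivity (\sum_(v : n.-tuple S) g v * \sum_b markov_step v b * phi (rcons v b)).
  rewrite -(IHn (fun v => \sum_b markov_step v b * phi (rcons v b))).
  apply: eq_bigr => w _; rewrite mulr_sumr.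
  rewrite sum_pair /= exchange_big /=.
  apply: eq_bigr => b _; rewrite mulrA -(sum_coupling_stepr (unzip1 w)) mulr_sumr mulr_suml.
  by apply: eq_bigr => a _; rewrite coupled_rcons /unzip2 map_rcons.
apply: eq_bigr => v _; rewrite mulr_sumr; apply: eq_bigr => b _.
by rewrite mulrA mul_markov_step.
Qed.

(* Probability that, started from (u, b) and moving independently, the two
   processes do not meet during the next j steps. *)
Fixpoint nomeet j u b : R :=
  if j is j'.+1 then
    \sum_a \sum_b' kf u a * T b b' * ((a != b')%:R * nomeet j' (rcons u a) b')
  else 1.

Lemma nomeet_ge0 j u b : 0 <= nomeet j u b.
Proof.
elim: j u b => //= j IHj u b; apply: sumr_ge0 => a _; apply: sumr_ge0 => b' _.
by rewrite !mulr_ge0 ?ler0n ?cond_law_ge0.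
Qed.

Lemma sum_kfT u b : \sum_a \sum_b' kf u a * T b b' = 1.
Proof.
under eq_bigr do rewrite -mulr_sumr T1 mulr1.
exact: sum_cond_law.
Qed.

Lemma nomeet_le1 j u b : nomeet j u b <= 1.
Proof.
elim: j u b => //= j IHj u b; rewrite -[leRHS](sum_kfT u b).
apply: ler_sum => a _; apply: ler_sum => b' _.
rewrite ler_piMr ?mulr_ge0 ?cond_law_ge0//.
by rewrite mulr_ile1 ?ler0n ?nomeet_ge0// lern1 leq_b1.
Qed.

Fixpoint law_after j u c : R :=
  if j is j'.+1 then \sum_a kf u a * law_after j' (rcons u a) c
  else (last s0 u == c)%:R.

Lemma law_after_ge0 j u c : 0 <= law_after j u c.
Proof.
elim: j u => [|j IHj] u /=; first exact: ler0n.
by apply: sumr_ge0 => a _; rewrite mulr_ge0 ?cond_law_ge0.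
Qed.

Lemma sum_law_after j u : \sum_c law_after j u c = 1.
Proof.
elim: j u => [|j IHj] u /=.
  rewrite (bigD1 (last s0 u))//= eqxx big1 ?addr0// => c.
  by rewrite eq_sym => /negbTE ->.
rewrite exchange_big /= -[RHS](sum_cond_law s0 T1 lf u); apply: eq_bigr => a _.
by rewrite -mulr_sumr IHj mulr1.
Qed.

(* Probability that the two independent processes agree at time j. *)
Definition meet_at j u b : R := \sum_c law_after j u c * mxpow T j b c.

Lemma meet_atS j u b :
  meet_at j.+1 u b = \sum_a \sum_b' kf u a * T b b' * meet_at j (rcons u a) b'.
Proof.
rewrite /meet_at /=; under eq_bigr do rewrite mulr_suml.
rewrite exchange_big /=; apply: eq_bigr => a _.
under [RHS]eq_bigr do rewrite mulr_sumr.
rewrite [RHS]exchange_big /=; apply: eq_bigr => c _.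
by rewrite mxpowS mulr_sumr; apply: eq_bigr => b' _; ring.
Qed.

Lemma meet_at_le1 j u b : meet_at j u b <= 1.
Proof.
rewrite -[leRHS](sum_law_after j u); apply: ler_sum => c _.
by rewrite ler_piMr ?law_after_ge0 ?mxpow_le1.
Qed.

(** Agreement at time j entails a meeting at some step up to j. In the induction, first steps that
    meet contribute 0 on the left and [1 - meet_at], which is nonnegative, on the right. *)
Lemma nomeet_le j u b : last s0 u != b -> nomeet j u b <= 1 - meet_at j u b.
Proof.
elim: j u b => [|j IHj] u b ub.
  rewrite /= lerBrDr gerDl /meet_at /= big1// => c _; rewrite mxpow0.
  case: eqP => [<-|_]; last by rewrite mul0r.
  by rewrite eq_sym (negbTE ub) mulr0.
rewrite meet_atS -{1}(sum_kfT u b) -sumrB; apply: ler_sum => a _.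
rewrite -sumrB; apply: ler_sum => b' _.
rewrite -{2}[kf u a * T b b']mulr1 -mulrBr ler_wpM2l ?mulr_ge0 ?cond_law_ge0//.
case: eqVneq => [_|ab]; first by rewrite mul0r subr_ge0 meet_at_le1.
by rewrite mul1r IHj ?last_rcons.
Qed.

Variables (k : nat) (q : R).
Hypothesis qT : forall a b, q <= mxpow T k a b.

(** [meet_at k u b] is an average of entries of [T^k], so it is at least q whatever the conditional
    laws of [f]. *)
Lemma nomeet_le_1B u b : last s0 u != b -> nomeet k u b <= 1 - q.
Proof.
move=> ub; apply: le_trans (nomeet_le k ub) _; rewrite lerD2l lerN2.
rewrite -[leLHS]mul1r -(sum_law_after k u) mulr_suml; apply: ler_sum => c _.
by rewrite ler_wpM2l ?law_after_ge0.
Qed.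

Variable delta : R.
Hypothesis f_step_le :
  forall n, \sum_(u : n.+1.-tuple S) f u * f_step u <= delta.

Definition mismatch (w : seq (S * S)) : bool :=
  last s0 (unzip1 w) != last s0 (unzip2 w).

(** Probability of a mismatch after n letters of the coupling followed by j independent steps
    without a meeting; it interpolates between the mismatch probability (j = 0) and its contraction
    (j = k). *)
Definition mismatch_potential n j : R := \sum_(w : n.-tuple (S * S)%type)
  coupled w * ((mismatch w)%:R * nomeet j (unzip1 w) (last s0 (unzip2 w))).

Definition mismatch_prob n : R :=
  \sum_(w : n.-tuple (S * S)%type) coupled w * (mismatch w)%:R.

(** From a mismatch the coupling moves independently, which is exactly the first step of
    [nomeet j.+1]. From an agreement a mismatch arises with probability at most [f_step], whose mean
    is at most delta. *)
Lemma mismatch_potential_step n j :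
  mismatch_potential n.+2 j <= mismatch_potential n.+1 j.+1 + delta.
Proof.
apply: (@le_trans _ _ (mismatch_potential n.+1 j.+1 +
    \sum_(w : n.+1.-tuple (S * S)%type) coupled w * f_step (unzip1 w))); last first.
  by rewrite coupled_marginall lerD2l.
rewrite /mismatch_potential (sum_tuple_rcons _ (fun w : seq (S * S) => coupled w *
  ((mismatch w)%:R * nomeet j (unzip1 w) (last s0 (unzip2 w))))).
rewrite -big_split /=; apply: ler_sum => w _.
rewrite sum_pair /=.
rewrite -mulrDr.
under eq_bigr do under eq_bigr do
  rewrite coupled_rcons /mismatch /unzip1 /unzip2 !map_rcons !last_rcons -mulrA.
under eq_bigr do rewrite -mulr_sumr.
rewrite -mulr_sumr; apply: ler_wpM2l; first exact: (word_law_ge0 coupled_word_law).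
rewrite -/(unzip1 w) -/(unzip2 w) /coupling_step /mismatch /=.
(* The word has length [n.+1], so the initial law does not intervene. *)
have -> : markov_step (unzip2 w) = T (last s0 (unzip2 w)).
  by case: w => -[].
case: eqVneq => [e|ne] /=; last first.
  by rewrite mul1r lerDl tv_ge0//; exact: sum_cond_law.
rewrite mul0r add0r /f_step e.
apply: le_trans (maximal_coupling_neq_le _ _); [|exact: sum_cond_law|by []].
apply: ler_sum => a _; apply: ler_sum => b _; apply: ler_wpM2l.
  by apply: maximal_coupling_ge0 => // *; [exact: cond_law_ge0 | exact: sum_cond_law].
by rewrite ler_piMr ?ler0n ?nomeet_le1.
Qed.

Lemma mismatch_potential_steps i n j :
  mismatch_potential (n.+1 + i) j <= mismatch_potential n.+1 (j + i) + i%:R * delta.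
Proof.
elim: i j => [|i IHi] j; first by rewrite !addn0 mul0r addr0.
rewrite addnS; apply: le_trans (mismatch_potential_step _ _) _.
by rewrite -natr1 mulrDl mul1r addrA lerD2r addnS -addSn.
Qed.

Lemma mismatch_probE n : mismatch_prob n = mismatch_potential n 0.
Proof. by apply: eq_bigr => w _; rewrite /= mulr1. Qed.

(** Trade the last k steps of the coupling for k independent ones, at cost delta each, then apply
    [nomeet_le_1B] to the mismatched words. *)
Lemma mismatch_prob_contract n :
  mismatch_prob (n.+1 + k) <= (1 - q) * mismatch_prob n.+1 + k%:R * delta.
Proof.
rewrite mismatch_probE; apply: le_trans (mismatch_potential_steps _ _ _) _.
rewrite lerD2r add0n mulr_sumr; apply: ler_sum => w _; rewrite [leRHS]mulrCA.
apply: ler_wpM2l; first exact: (word_law_ge0 coupled_word_law).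
rewrite /mismatch; case: eqP => /= [_|/eqP ne]; first by rewrite mul0r mulr0.
by rewrite mul1r mulr1 nomeet_le_1B.
Qed.

Lemma mismatch_prob_ge0 n : 0 <= mismatch_prob n.
Proof.
by apply: sumr_ge0 => w _; rewrite mulr_ge0 ?ler0n ?(word_law_ge0 coupled_word_law).
Qed.

Lemma mismatch_prob_le1 n : mismatch_prob n <= 1.
Proof.
rewrite -(sum_word_law n coupled_word_law); apply: ler_sum => w _.
by rewrite ler_piMr ?(word_law_ge0 coupled_word_law)// lern1 leq_b1.
Qed.

(** Sum the contraction over N consecutive times; shifting the index by k costs at most k, each
    probability being at most 1. *)
Lemma sum_mismatch_prob_le N :
  q * \sum_(0 <= i < N) mismatch_prob i.+1 <= k%:R + N%:R * (k%:R * delta).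
Proof.
set s := \sum_(0 <= i < N) _.
have h1 : s <= k%:R + \sum_(0 <= i < N) mismatch_prob (i.+1 + k).
  apply: (@le_trans _ _ (\sum_(0 <= i < N + k) mismatch_prob i.+1)).
    rewrite (big_cat_nat _ (n := N))//= ?leq_addr// lerDl.
    by apply: sumr_ge0 => i _; exact: mismatch_prob_ge0.
  rewrite addnC (big_cat_nat _ (n := k))//= ?leq_addr// lerD//.
    apply: (@le_trans _ _ (\sum_(0 <= i < k) 1)).
      by apply: ler_sum => i _; exact: mismatch_prob_le1.
    by rewrite big_const_nat subn0 iter_addr_0.
  by rewrite -{1}[k]add0n big_addn addKn.
have h2 : \sum_(0 <= i < N) mismatch_prob (i.+1 + k) <= (1 - q) * s + N%:R * (k%:R * delta).
  apply: (@le_trans _ _ (\sum_(0 <= i < N) ((1 - q) * mismatch_prob i.+1 + k%:R * delta))).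
    by apply: ler_sum => i _; exact: mismatch_prob_contract.
  rewrite big_split /= -mulr_sumr lerD2l.
  by rewrite big_const_nat subn0 iter_addr_0 [leRHS]mulr_natl.
lra.
Qed.

End coupled_process.

(** * Stationary limit of the coupling *)

(** Compactness of the segment gives a cluster point, and a cluster point of an ultrafilter is a
    limit. *)
Lemma ultra_bounded_cvg (R : realType) (U : set_system nat) (u : nat -> R) (a b : R) :
  UltraFilter U -> (forall n, a <= u n <= b) -> cvg (u @ U).
Proof.
move=> UU uab; have abE : (u @ U) [set` `[a, b]].
  by apply: (@filterS _ U _ setT) filterT => n _; rewrite /= in_itv /= uab.
have /(_ _ abE)[p [_ clp]] := @segment_compact R a b (u @ U) _.
apply/cvg_ex; exists p => B /= Bp.
have [//|nB] := in_ultra_setVsetC (u @^-1` B) UU.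
by have [x [] /=] := clp (~` B) B nB Bp.
Qed.

Lemma cvg_sum_fintype (R : realType) (I : finType) (U : set_system nat)
    (F : I -> nat -> R) (l : I -> R) : Filter U ->
  (forall i, F i @ U --> l i) -> (fun N => \sum_i F i N) @ U --> \sum_i l i.
Proof. by move=> FU Fl; apply: cvg_big => [|//]; exact: add_continuous. Qed.

Section cesaro_ultralimit.
Variables (R : realType) (B : finType) (t : seq B -> R).
Hypothesis lt : word_law t.

Definition shifted i w : R := \sum_(p : i.-tuple B) t (p ++ w).

Lemma shifted_word_law i : word_law (shifted i).
Proof.
split.
- by move=> w; apply: sumr_ge0 => p _; exact: word_law_ge0.
- by rewrite /shifted; under eq_bigr do rewrite cats0; exact: sum_word_law.
- move=> w; rewrite /shifted exchange_big /=; apply: eq_bigr => p _.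
  by under eq_bigr do rewrite -rcons_cat; exact: word_law_rcons.
Qed.

Lemma sum_shifted_cons i w : \sum_a shifted i (a :: w) = shifted i.+1 w.
Proof.
rewrite /shifted (sum_tuple_rcons i (fun p => t (p ++ w))) exchange_big /=.
by apply: eq_bigr => p _; apply: eq_bigr => a _; rewrite cat_rcons.
Qed.

(** A stationary marginal survives the shift: test the unshifted law with [phi] composed with
    [drop i], then forget the first i letters of [f]. *)
Lemma sum_shifted_map (S : finType) (pr : B -> S) (f : seq S -> R) i n
    (phi : seq S -> R) : stationary f ->
  (forall n (phi : seq S -> R), \sum_(w : n.-tuple B) t w * phi (map pr w) =
     \sum_(u : n.-tuple S) f u * phi u) ->
  \sum_(w : n.-tuple B) shifted i w * phi (map pr w) =
  \sum_(u : n.-tuple S) f u * phi u.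
Proof.
move=> sf tf; rewrite /shifted; under eq_bigr do rewrite mulr_suml.
rewrite exchange_big /=.
transitivity (\sum_(w : (i + n).-tuple B) t w * phi (drop i (map pr w))).
  rewrite (sum_tuple_cat i n (fun w => t w * phi (drop i (map pr w)))).
  apply: eq_bigr => p _; apply: eq_bigr => w _.
  by rewrite map_cat drop_size_cat// size_map size_tuple.
rewrite (tf (i + n)%N (fun u => phi (drop i u))).
rewrite (sum_tuple_cat i n (fun u => f u * phi (drop i u))).
rewrite exchange_big /=; apply: eq_bigr => w _.
rewrite -(stationary_cat i w sf) mulr_suml; apply: eq_bigr => p _.
by rewrite drop_size_cat// size_tuple.
Qed.

Definition shift_mean N w : R := N.+1%:R^-1 * \sum_(0 <= i < N.+1) shifted i w.

Lemma shift_mean_word_law N : word_law (shift_mean N).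
Proof.
split.
- move=> w; rewrite mulr_ge0 ?invr_ge0 ?ler0n//; apply: sumr_ge0 => i _.
  exact: (word_law_ge0 (shifted_word_law i)).
- rewrite /shift_mean (eq_bigr (fun=> 1)).
    by rewrite big_const_nat subn0 iter_addr_0 mulVf.
  by move=> i _; exact: (word_law_nil (shifted_word_law i)).
- move=> w; rewrite /shift_mean -mulr_sumr exchange_big /=; congr (_ * _).
  by apply: eq_bigr => i _; exact: (word_law_rcons (shifted_word_law i)).
Qed.

Lemma sum_shift_mean N n (phi : seq B -> R) :
  \sum_(w : n.-tuple B) shift_mean N w * phi w =
  N.+1%:R^-1 * \sum_(0 <= i < N.+1) \sum_(w : n.-tuple B) shifted i w * phi w.
Proof.
rewrite /shift_mean; under eq_bigr do rewrite -mulrA mulr_suml.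
by rewrite -mulr_sumr exchange_big.
Qed.

(** The sums telescope, leaving a defect of stationarity of order 1/N. *)
Lemma sum_shift_mean_cons N w : \sum_a shift_mean N (a :: w) =
  shift_mean N w + N.+1%:R^-1 * (shifted N.+1 w - shifted 0 w).
Proof.
rewrite /shift_mean -mulr_sumr exchange_big /= -mulrDr; congr (_ * _).
under eq_bigr do rewrite sum_shifted_cons.
by rewrite addrC [in RHS]big_nat_recl// addrA subrK big_nat_recr//= addrC.
Qed.

(** One ultrafilter finer than [\oo] makes the means converge on all words at once. The last clause
    lets marginals and mismatch probabilities pass to the limit. *)
Lemma cesaro_ultralimit : exists (U : set_system nat) (z : seq B -> R),
  [/\ ProperFilter U, \oo `<=` U, word_law z, stationary z &
      forall n (phi : seq B -> R),
        (fun N => N.+1%:R^-1 * \sum_(0 <= i < N.+1)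
           \sum_(w : n.-tuple B) shifted i w * phi w) @ U -->
        \sum_(w : n.-tuple B) z w * phi w].
Proof.
have [U [UU ooU]] := ultraFilterLemma eventually_filter.
pose z w := lim (shift_mean^~ w @ U).
have zE w : shift_mean^~ w @ U --> z w.
  apply: (ultra_bounded_cvg (a := 0) (b := 1)) => N.
  have lN := shift_mean_word_law N.
  by rewrite (word_law_ge0 lN) (word_law_le1 _ lN).
exists U, z; split => //; first exact: ultra_proper.
- split=> [w||w].
  + apply: (cvgr_to_ge (zE w)); apply: nearW => N.
    exact: (word_law_ge0 (shift_mean_word_law N)).
  + apply: (cvg_unique _ (zE [::])) => //.
    have -> : shift_mean^~ [::] = fun=> 1.
      by apply/funext => N; exact: (word_law_nil (shift_mean_word_law N)).
    exact: cvg_cst.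
  + apply: (cvg_unique _ _ (zE w)) => //.
    have -> : shift_mean^~ w = fun N => \sum_a shift_mean N (rcons w a).
      by apply/funext => N; rewrite (word_law_rcons (shift_mean_word_law N)).
    exact: cvg_sum_fintype.
- move=> w; apply: (cvg_unique _ (cvg_sum_fintype _ (fun a => zE (a :: w)))) => //.
  rewrite (funext (fun N => sum_shift_mean_cons N w)) -[z w]addr0.
  apply: cvgD => //.
  have: (fun N => N.+1%:R^-1 * (shifted N.+1 w - shifted 0 w)) @ \oo --> (0 : R).
    apply/norm_cvg0P.
    apply: (@squeeze_cvgr _ _ _ _ (fun=> 0) (@harmonic R)).
    - apply: nearW => N; rewrite normr_ge0 /= normrM ger0_norm ?invr_ge0 ?ler0n//.
      rewrite ler_piMr ?invr_ge0 ?ler0n//.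
      have l1 := shifted_word_law N.+1; have l2 := shifted_word_law 0.
      have := word_law_ge0 l1 w; have := word_law_ge0 l2 w.
      have := word_law_le1 w l1; have := word_law_le1 w l2.
      rewrite ler_norml; lra.
    - exact: cvg_cst.
    - exact: cvg_harmonic.
  by move=> h A /h; exact: ooU.
- move=> n phi; under eq_fun do rewrite -sum_shift_mean.
  apply: (cvg_sum_fintype (F := fun (w : n.-tuple B) N => shift_mean N w * phi w)) => w.
  by apply: cvgM => //; exact: cvg_cst.
Qed.

End cesaro_ultralimit.

Section stationary_coupling.
Variables (R : realType) (S : finType) (s0 : S) (T : S -> S -> R).
Hypotheses (T0 : forall a b, 0 <= T a b) (T1 : forall a, \sum_b T a b = 1).
Variables f g : seq S -> R.
Hypotheses (lf : word_law f) (sf : stationary f).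
Hypotheses (lg : word_law g) (sg : stationary g).
Hypothesis gT : forall v b, v != [::] -> g (rcons v b) = g v * T (last s0 v) b.
Variables (k : nat) (q delta : R).
Hypotheses (q0 : 0 < q) (qT : forall a b, q <= mxpow T k a b).
Hypothesis f_step_le : forall n, \sum_(u : n.+1.-tuple S)
  f u * tv (cond_law s0 T f u) (T (last s0 u)) <= delta.

(** Along the means both marginals are constant, and the mismatch is at most
    [(k / N.+1 + k * delta) / q]. *)
Lemma stationary_coupling : exists z : seq (S * S) -> R,
  [/\ word_law z, stationary z,
      forall n (phi : seq S -> R), \sum_(w : n.-tuple (S * S)%type) z w * phi (unzip1 w) =
        \sum_(u : n.-tuple S) f u * phi u,
      forall n (phi : seq S -> R), \sum_(w : n.-tuple (S * S)%type) z w * phi (unzip2 w) =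
        \sum_(v : n.-tuple S) g v * phi v &
      \sum_p z [:: p] * (p.1 != p.2)%:R <= k%:R * delta / q].
Proof.
pose t := coupled s0 T f g.
have lt : word_law t by exact: coupled_word_law.
have [U [z [UP ooU lz sz zE]]] := cesaro_ultralimit lt.
have mean_cst (F : nat -> R) c : (forall i, F i = c) ->
    (fun N => N.+1%:R^-1 * \sum_(0 <= i < N.+1) F i) @ U --> c.
  move=> Fc; rewrite (_ : (fun _ => _) = fun=> c); first exact: cvg_cst.
  apply/funext => N; rewrite (eq_bigr (fun=> c))// big_const_nat subn0 iter_addr_0.
  by rewrite -[X in _ * X]mulr_natl mulKf.
exists z; split => //.
- move=> n phi; apply: (cvg_unique _ (zE n (fun w => phi (unzip1 w)))) => //.
  by apply: mean_cst => i; exact: (sum_shifted_map _ _ _ sf (coupled_marginall s0 T0 T1 lf lg)).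
- move=> n phi; apply: (cvg_unique _ (zE n (fun w => phi (unzip2 w)))) => //.
  by apply: mean_cst => i; exact: (sum_shifted_map _ _ _ sg (coupled_marginalr T0 T1 lf lg gT)).
- have zm := zE 1 (fun w => (mismatch s0 w)%:R).
  have E (F : seq (S * S) -> R) : \sum_(w : 1.-tuple (S * S)%type) F w * (mismatch s0 w)%:R =
      \sum_p F [:: p] * (p.1 != p.2)%:R.
    rewrite (sum_tuple_cons 0 (fun w => F w * (mismatch s0 w)%:R)).
    by apply: eq_bigr => p _; rewrite (sum_tuple0 (fun w => F (p :: w) * (mismatch s0 (p :: w))%:R)).
  rewrite E in zm.
  have up : (fun N => (k%:R / N.+1%:R + k%:R * delta) / q : R) @ U --> k%:R * delta / q.
    have: (fun N => (k%:R / N.+1%:R + k%:R * delta) / q : R) @ \oo --> k%:R * delta / q.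
      apply: cvgM; last exact: cvg_cst.
      have := cvgD (cvgMl_tmp (a := k%:R) (@cvg_harmonic R)) (cvg_cst (k%:R * delta : R)).
      by rewrite mulr0 add0r; apply.
    by move=> h C /h; exact: ooU.
  apply: (ler_cvg_to zm up); apply: nearW => N.
  rewrite ler_pdivlMr// mulrC.
  (* The first letter after a shift by i is the last letter of a word of length [i.+1]. *)
  rewrite (eq_bigr (fun i => mismatch_prob s0 T f g i.+1)); last first.
    move=> i _; rewrite E /mismatch_prob.
    rewrite (sum_tuple_rcons i (fun w => t w * (mismatch s0 w)%:R)) exchange_big /=.
    apply: eq_bigr => p _; rewrite /shifted mulr_suml; apply: eq_bigr => w _.
    by rewrite cats1 /mismatch /unzip1 /unzip2 !map_rcons !last_rcons.
  rewrite mulrCA mulrC ler_pdivrMr ?ltr0n// mulrDl divfK// [_ * N.+1%:R]mulrC.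
  exact: sum_mismatch_prob_le.
Qed.

End stationary_coupling.

(** * Perron eigenvector and topological entropy *)

Lemma finite_pos_lbound (R : realType) (I : finType) (F : I -> R) :
  (forall i, 0 < F i) -> exists2 c, 0 < c & forall i, c <= F i.
Proof.
move=> F0; exists (\big[Num.min/1]_i F i) => [|i]; last exact: bigmin_le_cond.
by apply: lt_bigmin => // i _.
Qed.

Lemma mxpow_natr (R : realType) (S : finType) (A : rel S) n a b :
  mxpow (fun a b => (A a b)%:R : R) n a b =
  (mxpow (fun a b => nat_of_bool (A a b)) n a b)%:R.
Proof.
elim: n a => [|n IHn] a; first by rewrite !mxpow0; case: eqP.
by rewrite !mxpowS natr_sum; apply: eq_bigr => c _; rewrite IHn natrM.
Qed.

Lemma mxpowSr (S : finType) (K : pzSemiRingType) (M : S -> S -> K) k a b :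
  mxpow M k.+1 a b = \sum_c mxpow M k a c * M c b.
Proof.
rewrite /mxpow exprSr mxE (reindex enum_rank) /=; last first.
  by exists enum_val => ? _; [exact: enum_rankK | exact: enum_valK].
by apply: eq_bigr => c _; rewrite !mxE !enum_rankK.
Qed.

Section perron_eigenvector.
Variables (R : realType) (S : finType) (s0 : S) (M : S -> S -> R) (n : nat).
Hypothesis M0 : forall a b, 0 <= M a b.
Hypothesis n0 : (0 < n)%N.
Hypothesis Mn0 : forall a b, 0 < mxpow M n a b.
Implicit Types (x : S -> R) (t : R).

(* Collatz-Wielandt: the eigenvalue is the largest t for which such an x exists. *)
Let subinvariant t x := [/\ forall a, 0 <= x a, \sum_a x a = 1 &
  forall a, t * x a <= \sum_b M a b * x b].

Lemma mxpow_eigen t x k : (forall a, \sum_b M a b * x b = t * x a) ->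
  forall a, \sum_b mxpow M k a b * x b = t ^+ k * x a.
Proof.
move=> Mx; elim: k => [|k IHk] a.
  rewrite (bigD1 a)//= mxpow0 eqxx mul1r big1 ?addr0 ?expr0 ?mul1r// => b.
  by rewrite mxpow0 eq_sym => /negbTE ->; rewrite mul0r.
under eq_bigr do rewrite mxpowS mulr_suml.
rewrite exchange_big /=.
under eq_bigr do under eq_bigr do rewrite -mulrA.
under eq_bigr do rewrite -mulr_sumr IHk mulrCA.
by rewrite -mulr_sumr Mx exprSr mulrA.
Qed.

Let Mn_gt0 x : (forall a, 0 <= x a) -> (exists a, x a != 0) ->
  forall a, 0 < \sum_b mxpow M n a b * x b.
Proof.
move=> x0 [b xb] a; rewrite (bigD1 b)//= ltr_pwDl//.
  by rewrite mulr_gt0// lt_neqAle eq_sym xb x0.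
by apply: sumr_ge0 => c _; rewrite mulr_ge0// ltW.
Qed.

Let subinvariant_le t x : subinvariant t x -> t <= \sum_a \sum_b M a b.
Proof.
move=> [x0 x1 tx]; rewrite -[leLHS]mulr1 -x1 mulr_sumr; apply: ler_sum => a _.
apply: le_trans (tx a) _; apply: ler_sum => b _; rewrite ler_piMr//.
by rewrite -x1 (bigD1 b)//= lerDl; apply: sumr_ge0.
Qed.

(* Apply M^n to x: all inequalities become strict. *)
Let subinvariant_improve t x : 0 <= t -> subinvariant t x ->
  (exists a, \sum_b M a b * x b != t * x a) ->
  exists2 t', t < t' & exists x', subinvariant t' x'.
Proof.
move=> t0 [x0 x1 tx] [a xa].
pose y a := \sum_b M a b * x b - t * x a.
have y0 b : 0 <= y b by rewrite subr_ge0.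
pose z a := \sum_b mxpow M n a b * x b.
(* [M] commutes with its power, so the slack [y] of [x] becomes the slack [M^n y] of [z], which is
   positive everywhere. *)
have zE b : \sum_c M b c * z c = t * z b + \sum_c mxpow M n b c * y c.
  rewrite /z /y; under [X in _ = _ + X]eq_bigr do rewrite mulrBr.
  rewrite sumrB; under [X in _ = _ + (_ - X)]eq_bigr do rewrite mulrCA.
  rewrite -mulr_sumr addrC subrK.
  under eq_bigr do rewrite mulr_sumr.
  rewrite exchange_big /=.
  under eq_bigr do under eq_bigr do rewrite mulrA.
  under eq_bigr do rewrite -mulr_suml -mxpowS mxpowSr mulr_suml.
  rewrite exchange_big /=; apply: eq_bigr => c _; rewrite mulr_sumr.
  by apply: eq_bigr => d _; rewrite mulrA.
have x_neq0 : exists a, x a != 0.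
  apply: contrapT => /forallNP xN; move/eqP: x1; rewrite big1 ?(eq_sym 0) ?oner_eq0//.
  by move=> b _; apply/eqP; apply: contrapT => /negP; exact: xN.
have z0 b : 0 < z b by exact: Mn_gt0.
have [c c0 cy] : exists2 c, 0 < c & forall b, c <= \sum_d mxpow M n b d * y d.
  by apply: finite_pos_lbound; apply: Mn_gt0 => //; exists a; rewrite subr_eq0.
pose s := \sum_b z b.
have zs b : z b <= s.
  by rewrite /s (bigD1 b)//= lerDl; apply: sumr_ge0 => d _; exact: ltW.
have s_gt0 : 0 < s := lt_le_trans (z0 s0) (zs s0).
(* Since [z b <= s], the uniform slack c covers [(c / s) * z b]. *)
exists (t + c / s); first by rewrite ltrDl divr_gt0.
exists (fun b => z b / s); split.
- by move=> b; rewrite divr_ge0// ltW.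
- by rewrite -mulr_suml divff// gt_eqF.
- move=> b; under eq_bigr do rewrite mulrA.
  rewrite -mulr_suml mulrA ler_pM2r ?invr_gt0// zE mulrDl lerD2l.
  apply: le_trans (cy b); rewrite mulrAC ler_pdivrMr//.
  by rewrite ler_pM2l.
Qed.

(** An ultralimit of near-maximizers attains the supremum of the admissible t; if it were not an
    eigenvector, [subinvariant_improve] would exceed the supremum. *)
Lemma perron_eigenvector : exists lambda r,
  [/\ 0 < lambda, forall a, 0 < r a & forall a, \sum_b M a b * r b = lambda * r a].
Proof.
pose E := [set t | 0 <= t /\ exists x, subinvariant t x].
have supE : has_sup E.
  split.
    exists 0; split => //; exists (fun a => (a == s0)%:R); split.
    - by move=> a; exact: ler0n.
    - by rewrite (bigD1 s0)//= eqxx big1 ?addr0// => a /negbTE ->.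
    - by move=> a; rewrite mul0r; apply: sumr_ge0 => b _; rewrite mulr_ge0 ?ler0n.
  by exists (\sum_a \sum_b M a b) => t [_ [x /subinvariant_le]].
set lambda := sup E.
have E0 : E 0 by case: supE => -[t [t0 [x [x0 x1 tx]]]] _; split => //; exists x;
  split => // a; rewrite mul0r; apply: sumr_ge0 => b _; rewrite mulr_ge0.
have lambda_ge0 : 0 <= lambda by apply: sup_upper_bound.
have [u uE] : {u : nat -> S -> R & forall k, subinvariant (lambda - k.+1%:R^-1) (u k)}.
  apply: (@choice _ _ (fun k x => subinvariant (lambda - k.+1%:R^-1) x)) => k.
  have k0 : (0 : R) < k.+1%:R^-1 by rewrite invr_gt0.
  have [t [t0 [x [x0 x1 tx]]] lt] := sup_adherent k0 supE.
  exists x; split => // a; apply: le_trans (tx a); rewrite ler_wpM2r//.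
  exact: ltW.
have [U [UU ooU]] := ultraFilterLemma eventually_filter.
have UP : ProperFilter U := ultra_proper.
pose r a := lim (u^~ a @ U).
have rE a : u^~ a @ U --> r a.
  apply: (ultra_bounded_cvg (a := 0) (b := 1)) => k; have [x0 x1 _] := uE k.
  rewrite x0/= -x1 (bigD1 a)//= lerDl; exact: sumr_ge0.
have lr : subinvariant lambda r.
  split.
  - by move=> a; apply: (cvgr_to_ge (rE a)); apply: nearW => k; have [x0 _ _] := uE k.
  - apply: (cvg_unique _ (cvg_sum_fintype _ rE)) => //.
    rewrite (_ : (fun _ => _) = fun=> 1); first exact: cvg_cst.
    by apply/funext => k; have [_ x1 _] := uE k.
  - move=> a.
    have h1 : (fun k => (lambda - k.+1%:R^-1) * u k a) @ U --> lambda * r a.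
      have h : (fun k => lambda - k.+1%:R^-1) @ U --> lambda.
        have h' : (fun k => lambda - k.+1%:R^-1) @ \oo --> lambda - 0.
          by apply: cvgB; [exact: cvg_cst | exact: cvg_harmonic].
        by rewrite subr0 in h' => C /h'; exact: ooU.
      exact: cvgM h (rE a).
    have h2 : (fun k => \sum_b M a b * u k b) @ U --> \sum_b M a b * r b.
      apply: (cvg_sum_fintype (F := fun b k => M a b * u k b)) => b.
      by apply: cvgM => //; exact: cvg_cst.
    by apply: (ler_cvg_to h1 h2); apply: nearW => k; have [_ _] := uE k.
have eig a : \sum_b M a b * r b = lambda * r a.
  apply/eqP; apply: contrapT => /negP ne.
  have [t lt_t [x tx]] := subinvariant_improve lambda_ge0 lr (ex_intro _ a ne).
  have Et : E t by split; [exact: ltW (le_lt_trans lambda_ge0 lt_t) | exists x].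
  by have := sup_upper_bound supE Et; rewrite leNgt lt_t.
have [r0 r1 _] := lr.
have r_neq0 : exists a, r a != 0.
  apply: contrapT => /forallNP xN; move/eqP: r1; rewrite big1 ?(eq_sym 0) ?oner_eq0//.
  by move=> b _; apply/eqP; apply: contrapT => /negP; exact: xN.
(* This is [M^n r] at a; it yields positivity of both factors, of lambda because [0 ^+ n = 0] for
   positive n. *)
have pos a : 0 < lambda ^+ n * r a.
  by rewrite -(mxpow_eigen n eig); exact: Mn_gt0.
have lambda_gt0 : 0 < lambda.
  rewrite lt_neqAle lambda_ge0 andbT; apply/eqP => l0.
  by have := pos s0; rewrite -l0 expr0n gtn_eqF// mul0r ltxx.
exists lambda, r; split => // a.
by have := pos a; rewrite pmulr_rgt0 ?exprn_gt0.
Qed.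

End perron_eigenvector.

(** * Counting admissible words *)

Section topological_entropy.
Variables (R : realType) (S : finType) (s0 : S) (A : rel S) (lambda : R).
Variable r : S -> R.
Hypotheses (lambda0 : 0 < lambda) (r0 : forall a, 0 < r a).
Hypothesis rE : forall a, \sum_b (A a b)%:R * r b = lambda * r a.

Lemma ex_successor a : exists b, A a b.
Proof.
apply: contrapT => /forallNP Aa; have := rE a; rewrite big1 => [/esym/eqP|b _].
  by rewrite gt_eqF ?mulr_gt0.
by have /negP/negbTE -> := Aa b; rewrite mul0r.
Qed.

(** Every letter has a successor, so an admissible word extends to a point of the shift by iterating
    a choice of successors. *)
Lemma mem_language n (w : n.+1.-tuple S) : (w \in language s0 A n.+1) = sorted A w.
Proof.
rewrite inE; apply/asboolP/idP => [[x [Ax xw]]|Aw].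
  apply/(sortedP s0) => i; rewrite size_tuple => lt_i.
  have := xw (Ordinal lt_i); rewrite (tnth_nth s0) /= => <-.
  have := xw (Ordinal (ltnW lt_i)); rewrite (tnth_nth s0) /= => <-.
  exact: Ax.
have [succ As] : {succ : S -> S & forall a, A a (succ a)}.
  exact: (@choice _ _ (fun a b => is_true (A a b)) ex_successor).
exists (fun i => if (i <= n)%N then nth s0 w i else iter (i - n) succ (nth s0 w n)).
split=> [i|i]; last by rewrite -ltnS ltn_ord (tnth_nth s0).
case: (ltngtP i n) => [|lt_ni|->] /=.
- by move=> lt_in; move/(sortedP s0): Aw => /(_ i); rewrite size_tuple; exact.
- by rewrite subSn 1?ltnW// iterS.
- by rewrite subSnn.
Qed.

(** Weighting the last letter by the eigenvector makes the count of admissible words exactly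
    geometric. *)
Let weight w : R := (sorted A w)%:R * r (last s0 w).

Let sum_weight n :
  \sum_(w : n.+1.-tuple S) weight w = lambda ^+ n * \sum_a r a.
Proof.
elim: n => [|n IHn].
  rewrite (sum_tuple_cons 0 weight) expr0 mul1r; apply: eq_bigr => a _.
  by rewrite (sum_tuple0 (fun w => weight (a :: w))) /weight /= mul1r.
rewrite (sum_tuple_rcons n.+1 weight) exprS -mulrA -IHn mulr_sumr.
apply: eq_bigr => w _; rewrite /weight mulrCA -rE mulr_sumr.
apply: eq_bigr => a _; rewrite last_rcons.
have -> : sorted A (rcons w a) = sorted A w && A (last s0 w) a.
  by case: w => -[//|b w] _ /=; rewrite rcons_path.
by rewrite mulrA -natrM mulnb.
Qed.

Lemma card_language_bounds : exists c1 c2 : R, [/\ 0 < c1, 0 < c2 &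
  forall n, c1 * lambda ^+ n <= #|language s0 A n.+1|%:R <= c2 * lambda ^+ n].
Proof.
have [c c0 cr] := finite_pos_lbound r0.
pose s := \sum_a r a.
have rs a : r a <= s.
  by rewrite /s (bigD1 a)//= lerDl; apply: sumr_ge0 => b _; exact: ltW.
have s_gt0 : 0 < s := lt_le_trans (r0 s0) (rs s0).
(* With [r] between c and s, the weighted count [lambda ^+ n * s] lies between c times and s times
   the number of words. *)
exists (s / s), (s / c); split; rewrite ?divr_gt0// => n.
have -> : (#|language s0 A n.+1|%:R : R) = \sum_(w : n.+1.-tuple S) (sorted A w)%:R.
  rewrite -sum1_card natr_sum big_mkcond; apply: eq_bigr => w _.
  by rewrite mem_language; case: sorted.
rewrite mulrAC [s / c * _]mulrAC ler_pdivrMr// ler_pdivlMr// ![s * _]mulrC -sum_weight.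
rewrite !mulr_suml; apply/andP; split; apply: ler_sum => w _.
  by rewrite ler_wpM2l.
by rewrite ler_wpM2l.
Qed.

Lemma htopE : htop R s0 A = ln lambda.
Proof.
have [c1 [c2 [c10 c20 cb]]] := card_language_bounds.
apply: cvg_lim => //; rewrite -cvg_shiftS /=.
have h (c : R) : (fun n => n.+1%:R^-1 * (c + n%:R * ln lambda)) @ \oo --> ln lambda.
  have -> : (fun n => n.+1%:R^-1 * (c + n%:R * ln lambda)) =
      (fun n => (c - ln lambda) * harmonic n + ln lambda).
    by apply/funext => n; rewrite /harmonic /= -natr1; field; rewrite natr1.
  rewrite -[X in _ @ _ --> X]add0r -[X in _ --> X + _](mulr0 (c - ln lambda)).
  by apply: cvgD; [exact: cvgMl_tmp cvg_harmonic | exact: cvg_cst].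
apply: (squeeze_cvgr _ (h (ln c1)) (h (ln c2))); apply: nearW => n.
have /andP[lb ub] := cb n.
have ln0 : 0 < lambda ^+ n by rewrite exprn_gt0.
have L0 : 0 < #|language s0 A n.+1|%:R :> R by apply: lt_le_trans lb; rewrite mulr_gt0.
rewrite !ler_pM2l ?invr_gt0// mulr_natl -lnXn// -!lnM ?posrE//.
by rewrite !ler_ln ?posrE ?mulr_gt0// lb.
Qed.

End topological_entropy.

(** * Borel measures on symbolic spaces *)

Section symbolic_coding.
Variables (B : finType) (Y : pointedType) (O : set (set Y)) (code : Y -> nat -> B).
Local Notation YO := (g_sigma_algebraType O).

(** The abstract coding serves both the space of sequences, coded by itself, and its square, coded
    by pairs of letters. *)
Definition code_cylinder (w : seq B) : set YO :=
  [set y | mkseq (code y) (size w) = w].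

Hypothesis cyl_open : forall w, O (code_cylinder w).
Hypothesis cyl_base : forall (U : set Y) y, O U -> U y ->
  exists n, code_cylinder (mkseq (code y) n) `<=` U.

Definition cylinders : set (set YO) :=
  [set C | C = set0 \/ exists w, C = code_cylinder w].

Lemma cylinder_nil : code_cylinder [::] = setT.
Proof. by apply/seteqP; split. Qed.

Lemma code_cylinder_mkseq y n : code_cylinder (mkseq (code y) n) y.
Proof. by rewrite /code_cylinder /= size_mkseq. Qed.

Lemma take_mkseq (T : Type) (h : nat -> T) m n : (m <= n)%N ->
  take m (mkseq h n) = mkseq h m.
Proof. by move=> mn; rewrite /mkseq -map_take take_iota (minn_idPl mn). Qed.

Lemma cylinders_setI : setI_closed cylinders.
Proof.
suff h v w : (size v <= size w)%N -> cylinders (code_cylinder v `&` code_cylinder w).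
  move=> C D [->|[v ->]]; first by rewrite set0I; left.
  move=> [->|[w ->]]; first by rewrite setI0; left.
  have [vw|wv] := leqP (size v) (size w); first exact: h.
  by rewrite setIC; apply: h; exact: ltnW.
move=> vw; have [vE|vN] := pselect (take (size v) w = v).
  right; exists w; apply/seteqP; split=> [y [_ //]|y yw]; split => //.
  by rewrite /code_cylinder /= -(take_mkseq _ vw) yw.
left; apply/seteqP; split => // y [yv yw]; apply: vN.
by rewrite -[in LHS]yw take_mkseq.
Qed.

(** An open set is the union of the cylinders it contains, and there are countably many words. *)
Lemma borel_cylinders : @measurable _ YO = <<s cylinders >>.
Proof.
apply/seteqP; split.
  apply: smallest_sub; first exact: smallest_sigma_algebra.
  move=> U oU; pose F w := if `[< code_cylinder w `<=` U >] then code_cylinder w else set0.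
  have -> : U = \bigcup_w F w.
    apply/seteqP; split=> [y Uy|y [w _]]; last by rewrite /F; case: asboolP => // ; apply.
    have [n ncyl] := cyl_base oU Uy; exists (mkseq (code y) n) => //.
    by rewrite /F; case: asboolP => // _; exact: code_cylinder_mkseq.
  apply: (@countable_bigcupT_measurable _ (g_sigma_algebraType cylinders) (seq B)) => [|w].
    exact: countableP.
  apply: sub_sigma_algebra; rewrite /F; case: asboolP => _; last by left.
  by right; exists w.
apply: smallest_sub; first exact: smallest_sigma_algebra.
move=> C [->|[w ->]]; first exact: measurable0.
by apply: sub_sigma_algebra; exact: cyl_open.
Qed.

Lemma measurable_code_cylinder w : measurable (code_cylinder w).
Proof. by apply: sub_sigma_algebra; exact: cyl_open. Qed.

Lemma probability_unique (R : realType) (P1 P2 : probability YO R) :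
  (forall w, P1 (code_cylinder w) = P2 (code_cylinder w)) ->
  forall C, measurable C -> P1 C = P2 C.
Proof.
move=> P12 C mC.
apply: (measure_unique cylinders (fun=> setT)) => //.
- exact: borel_cylinders.
- exact: cylinders_setI.
- by move=> _; right; exists [::]; rewrite cylinder_nil.
- by rewrite bigcup_const.
- by move=> D [->|[w ->]]; [rewrite !measure0 | exact: P12].
- by move=> _; rewrite -ge0_fin_numE ?fin_num_measure.
Qed.

Lemma measurable_to_borel d (T : measurableType d) (h : T -> YO) :
  (forall w, measurable (h @^-1` code_cylinder w)) -> measurable_fun setT h.
Proof.
move=> hm; apply: (@measurability _ _ T YO setT h cylinders borel_cylinders) => _ [C [->|[w ->]] <-].
  by rewrite preimage_set0 setI0.
by rewrite setTI.
Qed.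

End symbolic_coding.

Section config_cylinders.
Variables (S : finType) (s0 : S).
Local Notation X := (config s0).

Definition pair_code (z : X * X) (i : nat) : S * S := (z.1 i, z.2 i).

Lemma nbhs_coord (x : X) i : nbhs x [set y : X | y i = x i].
Proof.
apply: (@proj_continuous nat (fun=> discrete_topology S) i x [set x i]).
exact: discrete_set1.
Qed.

Lemma nbhs_coords (x : X) n : nbhs x [set y : X | mkseq y n = mkseq x n].
Proof.
have : nbhs x [set y : X | forall i : 'I_n, y i = x i].
  exact: (@filter_forall X 'I_n (fun i => [set y : X | y i = x i]) (nbhs x)
    (nbhs_filter x) (fun i : 'I_n => nbhs_coord x i)).
apply: filterS => y /= yx; apply: (@eq_from_nth _ s0); rewrite ?size_mkseq// => i lt_i.
by rewrite !nth_mkseq// (yx (Ordinal lt_i)).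
Qed.

Lemma config_cvg (F : set_system X) (x : X) : Filter F ->
  (forall i, F [set y : X | y i = x i]) -> F --> x.
Proof.
move=> FF Fx; apply/cvg_sup => i U [V] [[W] oW <-] Wx WU.
by apply: (filterS WU); apply: filterS (Fx i) => y /= ->.
Qed.

Lemma coords_filter (T B : Type) (c : T -> nat -> B) (y : T) :
  Filter (filter_from setT (fun n => [set z | mkseq (c z) n = mkseq (c y) n])).
Proof.
apply: filter_fromT_filter; first by exists 0%N.
move=> i j; exists (maxn i j) => z /= zy.
split => /=.
  by rewrite -(take_mkseq _ (leq_maxl i j)) zy take_mkseq ?leq_maxl.
by rewrite -(take_mkseq _ (leq_maxr i j)) zy take_mkseq ?leq_maxr.
Qed.

Lemma mkseq_eq_nth (T : Type) (h h' : nat -> T) n i : (i < n)%N ->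
  mkseq h n = mkseq h' n -> h i = h' i.
Proof.
move=> lt_in hh'.
by rewrite -(nth_mkseq (h 0%N) h lt_in) hh' nth_mkseq.
Qed.

Lemma config_cyl_open (w : seq S) : @open X (code_cylinder (O := @open X) id w).
Proof.
rewrite openE => x /= xw; rewrite /interior -xw.
by apply: filterS (nbhs_coords x (size w)) => y /=; rewrite /code_cylinder /= size_mkseq.
Qed.

Lemma config_cyl_base (U : set X) (x : X) : open U -> U x ->
  exists n, code_cylinder (O := @open X) id (mkseq x n) `<=` U.
Proof.
move=> oU Ux; have FF := coords_filter (id : X -> nat -> S) x.
have /(_ U) : filter_from setT (fun n => [set z : X | mkseq z n = mkseq x n]) --> x.
  apply: config_cvg => i; exists i.+1 => // y /=.
  exact: (mkseq_eq_nth (ltnSn i)).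
case=> [|n _ nU]; first exact: open_nbhs_nbhs.
by exists n => y; rewrite /code_cylinder /= size_mkseq; exact: nU.
Qed.

Lemma pair_cyl_open w : @open (X * X)%type (code_cylinder (O := @open (X * X)%type) pair_code w).
Proof.
rewrite openE => -[x y] /= xyw; rewrite /interior -xyw.
exists ([set x' : X | mkseq x' (size w) = mkseq x (size w)],
        [set y' : X | mkseq y' (size w) = mkseq y (size w)]).
  by split; exact: nbhs_coords.
case=> x' y' [/= xx' yy'].
rewrite /code_cylinder /= size_mkseq; apply/eq_in_map => i; rewrite mem_iota add0n => /= lt_i.
by rewrite /pair_code /= (mkseq_eq_nth lt_i xx') (mkseq_eq_nth lt_i yy').
Qed.

Lemma pair_cyl_base (U : set (X * X)) z : open U -> U z ->
  exists n, code_cylinder (O := @open (X * X)%type) pair_code (mkseq (pair_code z) n) `<=` U.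
Proof.
move=> oU Uz; have : nbhs z U by exact: open_nbhs_nbhs.
case: z {Uz} => x y [[V W] /= [Vx Wy] VWU].
move: Vx Wy; rewrite !nbhsE => -[V' [oV' V'x] V'V] [W' [oW' W'y] W'W].
have [i iV] := config_cyl_base oV' V'x; have [j jW] := config_cyl_base oW' W'y.
exists (maxn i j) => -[x' y'] /=; rewrite /code_cylinder /= size_mkseq => xyE.
apply: VWU; split => /=.
  apply: V'V; apply: iV; rewrite /code_cylinder /= size_mkseq.
  apply/eq_in_map => l; rewrite mem_iota add0n => /= lt_l.
  by have /(congr1 fst) := mkseq_eq_nth (leq_trans lt_l (leq_maxl i j)) xyE.
apply: W'W; apply: jW; rewrite /code_cylinder /= size_mkseq.
apply/eq_in_map => l; rewrite mem_iota add0n => /= lt_l.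
by have /(congr1 snd) := mkseq_eq_nth (leq_trans lt_l (leq_maxr i j)) xyE.
Qed.

End config_cylinders.

(** * Nested intervals with prescribed lengths *)

Section nested_intervals.
Variables (R : realType) (B : finType) (b0 : B) (z : seq B -> R).
Hypothesis lz : word_law z.

Let letter i := nth b0 (enum B) i.

Let cum w i : R := \sum_(0 <= j < i) z (rcons w (letter j)).

Let cum_card w : cum w #|B| = z w.
Proof.
by rewrite /cum cardE -(big_nth b0 predT (fun a => z (rcons w a))) big_enum word_law_rcons.
Qed.

Let le_cum w i j : (i <= j)%N -> cum w i <= cum w j.
Proof.
move=> ij; rewrite /cum (big_cat_nat _ ij)//= lerDl; apply: sumr_ge0 => l _.
exact: word_law_ge0.
Qed.

Let rank a := index a (enum B).

Let rank_lt a : (rank a < #|B|)%N.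
Proof. by rewrite cardE index_mem mem_enum. Qed.

Let cum_rank w a : cum w (rank a).+1 = cum w (rank a) + z (rcons w a).
Proof. by rewrite /cum big_nat_recr//= /letter nth_index// mem_enum. Qed.

(** The cell of w is an interval of length [z w]; the cells of its one-letter extensions tile it
    from left to right in the order of [enum B]. *)
Fixpoint rev_left_end w : R :=
  if w is a :: w' then rev_left_end w' + cum (rev w') (rank a) else 0.

Definition left_end w := rev_left_end (rev w).

Lemma left_end_rcons w a : left_end (rcons w a) = left_end w + cum w (rank a).
Proof. by rewrite /left_end rev_rcons /= revK. Qed.

Definition in_cell w (t : R) := left_end w <= t < left_end w + z w.

Lemma in_cell_nil t : in_cell [::] t = (0 <= t < 1).
Proof. by rewrite /in_cell /left_end /= word_law_nil// add0r. Qed.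

Let cum_ge0 w i : 0 <= cum w i.
Proof. by apply: sumr_ge0 => j _; exact: word_law_ge0. Qed.

Let cum_rank_le w a : cum w (rank a) + z (rcons w a) <= z w.
Proof. by rewrite -cum_rank -[leRHS]cum_card; apply: le_cum; exact: rank_lt. Qed.

Lemma left_end_ge0 w : 0 <= left_end w.
Proof.
elim/last_ind: w => [|w a IHw]; first exact: lexx.
by rewrite left_end_rcons addr_ge0.
Qed.

Lemma right_end_le1 w : left_end w + z w <= 1.
Proof.
elim/last_ind: w => [|w a IHw]; first by rewrite /left_end /= word_law_nil// add0r.
by rewrite left_end_rcons -addrA (le_trans _ IHw)// lerD2l.
Qed.

Lemma in_cell_rcons w a t : in_cell (rcons w a) t -> in_cell w t.
Proof.
rewrite /in_cell left_end_rcons => /andP[h1 h2]; apply/andP; split.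
  by apply: le_trans h1; rewrite lerDl.
by apply: lt_le_trans h2 _; rewrite -addrA lerD2l.
Qed.

(** Descend through the partial sums [cum w n] until one no longer exceeds [t - left_end w]. *)
Lemma in_cell_ex w t : in_cell w t -> exists a, in_cell (rcons w a) t.
Proof.
move=> /andP[h1 h2].
have : t < left_end w + cum w #|B| by rewrite cum_card.
have : (#|B| <= #|B|)%N by [].
move: {1 3}#|B|; elim=> [|n IHn] ltB.
  by rewrite /cum big_nil addr0 ltNge h1.
have [lt_t _|ge_t lt_t] := ltP t (left_end w + cum w n).
  exact: IHn (ltnW ltB) lt_t.
have rn : rank (letter n) = n.
  by rewrite /rank /letter index_uniq ?enum_uniq// -cardE.
exists (letter n); rewrite /in_cell left_end_rcons rn ge_t /=.
by rewrite -addrA -{1}rn -cum_rank rn.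
Qed.

Lemma in_cell_uniq w a b t :
  in_cell (rcons w a) t -> in_cell (rcons w b) t -> a = b.
Proof.
wlog ab : a b / (rank a <= rank b)%N => [H|].
  by case: (leqP (rank a) (rank b)) => [/H//|/ltnW/H h1 h2 h3]; exact/esym/h1.
rewrite /in_cell !left_end_rcons => /andP[_ h1] /andP[h2 _].
move: ab; rewrite leq_eqVlt => /orP[/eqP rab|ab].
  by rewrite -(nth_index b0 (mem_enum B a)) -/(rank a) rab nth_index ?mem_enum.
have : t < t; last by rewrite ltxx.
apply: lt_le_trans h1 _; apply: le_trans h2; rewrite -addrA -cum_rank lerD2l.
exact: le_cum.
Qed.

Definition next_letter w t : B := odflt b0 [pick a | in_cell (rcons w a) t].

Fixpoint cell_word t n : seq B :=
  if n is n'.+1 then rcons (cell_word t n') (next_letter (cell_word t n') t)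
  else [::].

(** The analogue of the digit expansion of t for this partition. *)
Definition realization t n := next_letter (cell_word t n) t.

Lemma mkseq_realization t n : mkseq (realization t) n = cell_word t n.
Proof.
by elim: n => // n IHn; rewrite mkseqS IHn.
Qed.

Lemma in_cell_word t n : 0 <= t < 1 -> in_cell (cell_word t n) t.
Proof.
move=> t01; elim: n => [|n IHn] /=; first by rewrite in_cell_nil.
rewrite /next_letter; case: pickP => [a //|none].
by have [a] := in_cell_ex IHn; rewrite none.
Qed.

Lemma cell_word_eq w t : in_cell w t -> cell_word t (size w) = w.
Proof.
elim/last_ind: w => // w a IHw wa; rewrite size_rcons /=.
rewrite (IHw (in_cell_rcons wa)); congr rcons.
rewrite /next_letter; case: pickP => [b wb|/(_ a)]; last by rewrite wa.
exact: in_cell_uniq wb wa.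
Qed.

Lemma cell_word_out n t : ~~ (0 <= t < 1) -> cell_word t n = nseq n b0.
Proof.
move=> t01; elim: n => // n IHn; rewrite -[in RHS]addn1 nseqD cats1 /= IHn; congr rcons.
rewrite /next_letter; case: pickP => [b|//].
have none w : ~~ in_cell w t.
  by elim/last_ind: w => [|w a IHw]; [rewrite in_cell_nil|apply: contra IHw; exact: in_cell_rcons].
by rewrite (negbTE (none _)).
Qed.

(* Points outside [0, 1) lie in no cell; the junk letter b0 is read there. *)
Lemma realization_preimage w :
  [set t | mkseq (realization t) (size w) = w] =
  [set` `[left_end w, left_end w + z w[] `|`
  (if w == nseq (size w) b0 then ~` [set` `[0, 1[] else set0).
Proof.
apply/seteqP; split=> t /=; rewrite mkseq_realization.
  move=> tw; have [t01|t01] := boolP (0 <= t < 1).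
    left; rewrite in_itv /= -/(in_cell w t) -tw; exact: in_cell_word.
  right; rewrite -{1}tw cell_word_out// eqxx /= in_itv /=; exact/negP.
rewrite in_itv /= => -[/cell_word_eq//|].
case: eqP => //= wE; rewrite in_itv /= => /negP t01.
by rewrite cell_word_out.
Qed.

End nested_intervals.

Lemma pushforward_probability d d' (T : measurableType d) (T' : measurableType d')
    (R : realType) (P : probability T R) (h : T -> T') : measurable_fun setT h ->
  exists Q : probability T' R, forall C, Q C = P (h @^-1` C).
Proof.
move=> mh; pose h' : {mfun T >-> T'} := HB.pack h (@isMeasurableFun.Build _ _ _ _ h mh).
by exists (distribution P h').
Qed.

Lemma uniform_itv (R : realType) (a b : R) : 0 <= a -> a <= b -> b <= 1 ->
  uniform_prob (@ltr01 R) [set` `[a, b[] = (b - a)%:E.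
Proof.
move=> a0 ab b1; rewrite /uniform_prob integral_uniform_pdf.
rewrite (_ : _ `&` _ = [set` `[a, b[]); last first.
  rewrite setIidl// => t /=; rewrite !in_itv /= => /andP[h1 h2].
  by rewrite (le_trans a0 h1) (le_trans (ltW h2) b1).
rewrite (eq_integral (fun=> 1%:E)); last first.
  move=> t; rewrite inE /= in_itv /= => /andP[h1 h2]; rewrite /uniform_pdf.
  rewrite subr0 invr1.
  by rewrite (le_trans a0 h1) (le_trans (ltW h2) b1).
rewrite integral_cst//= mul1e lebesgue_measure_itv /= lte_fin.
by case: ltgtP ab => // -> _; rewrite subrr.
Qed.


(** Kolmogorov extension by pushing the uniform law on the unit interval through [realization]: the
    preimage of the cylinder of w is an interval of length [z w], up to a null set. *)
Lemma word_law_measure (R : realType) (B : finType) (Y : pointedType)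
    (O : set (set Y)) (code : Y -> nat -> B) (decode : (nat -> B) -> Y)
    (b0 : B) (z : seq B -> R) : word_law z ->
  (forall w, O (code_cylinder (O := O) code w)) ->
  (forall U y, O U -> U y ->
     exists n, code_cylinder (O := O) code (mkseq (code y) n) `<=` U) ->
  (forall h, code (decode h) =1 h) ->
  exists P : probability (g_sigma_algebraType O) R,
    forall w, P (code_cylinder (O := O) code w) = (z w)%:E.
Proof.
move=> lz cyl_open cyl_base decodeK.
pose h (t : measurableTypeR R) : g_sigma_algebraType O := decode (realization b0 z t).
have hE w : h @^-1` code_cylinder (O := O) code w =
    [set t | mkseq (realization b0 z t) (size w) = w].
  apply/seteqP; split=> t /=; rewrite /code_cylinder /=;
    by rewrite (eq_mkseq (decodeK _)).
have mh : measurable_fun setT h.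
  apply: (measurable_to_borel cyl_open cyl_base) => w; rewrite hE realization_preimage//.
  apply: measurableU; first exact: measurable_itv.
  by case: eqP => // _; apply: measurableC; exact: measurable_itv.
have [P PE] := pushforward_probability (uniform_prob (@ltr01 R)) mh.
exists P => w; rewrite PE hE realization_preimage//.
rewrite measureU0 /=.
- by rewrite uniform_itv ?left_end_ge0 ?lerDl ?word_law_ge0 ?right_end_le1// addrC addKr.
- exact: measurable_itv.
- by case: eqP => // _; apply: measurableC; exact: measurable_itv.
- case: eqP => // _; rewrite probability_setC; last exact: measurable_itv.
  by rewrite /= uniform_itv ?ler01// subr0 subee.
Qed.

(** * Joinings *)

Lemma measure_bigcup_fintype d (T : measurableType d) (R : realType)
    (mu : {measure set T -> \bar R}) (I : finType) (F : I -> set T) :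
  (forall i, measurable (F i)) -> (forall i j x, F i x -> F j x -> i = j) ->
  mu (\bigcup_i F i) = (\sum_i mu (F i))%E.
Proof.
move=> mF Fij; rewrite measure_fin_bigcup//.
- rewrite (fsbig_fwiden (index_enum I))//; first by move=> i _ /=; exact: mem_index_enum.
  + exact: index_enum_uniq.
  + by move=> i [_ []].
- by rewrite (_ : setT = [set` I]) ?finite_finpred//; apply/seteqP; split.
- by move=> i j _ _ [x [Fi Fj]]; exact: Fij Fi Fj.
Qed.

Lemma full_measure_setI d (T : measurableType d) (R : realType)
    (P : probability T R) (A C : set T) : measurable A -> measurable C ->
  P A = 1%E -> P (A `&` C) = P C.
Proof.
move=> mA mC PA; rewrite [RHS](measureDI _ mC mA) setIC [X in (X + _)%E](_ : _ = 0%E) ?add0e//.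
apply/eqP; rewrite -measure_le0.
have <- : P (~` A) = 0%E by rewrite probability_setC// PA subee.
apply: le_measure; rewrite ?inE; [exact: measurableD | exact: measurableC |].
by move=> x [].
Qed.

Section cylinder_probabilities.
Variables (R : realType) (B : finType) (Y : pointedType) (O : set (set Y)).
Variable code : Y -> nat -> B.
Hypothesis cyl_open : forall w, O (code_cylinder (O := O) code w).
Variable P : probability (g_sigma_algebraType O) R.

Definition cyl_prob (w : seq B) : R := fine (P (code_cylinder (O := O) code w)).

Lemma cyl_probE w : P (code_cylinder (O := O) code w) = (cyl_prob w)%:E.
Proof.
by rewrite fineK// fin_num_measure//; exact: (measurable_code_cylinder cyl_open).
Qed.

Let F n (p : pred (seq B)) (w : n.-tuple B) : set (g_sigma_algebraType O) :=
  if p w then code_cylinder (O := O) code w else set0.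

Let mF n p w : measurable (@F n p w).
Proof.
by rewrite /F; case: ifP => // _; exact: (measurable_code_cylinder cyl_open).
Qed.

Let prefix_setE n (p : pred (seq B)) :
  [set y | p (mkseq (code y) n)] = \bigcup_w @F n p w.
Proof.
apply/seteqP; split=> [y py|y [w _]].
  exists [tuple of mkseq (code y) n] => //; rewrite /F /= py.
  exact: code_cylinder_mkseq.
by rewrite /F; case: ifP => // pw; rewrite /code_cylinder /= size_tuple => ->.
Qed.

Lemma measurable_prefix_set n (p : pred (seq B)) :
  measurable ([set y | p (mkseq (code y) n)] : set (g_sigma_algebraType O)).
Proof.
rewrite prefix_setE; apply: fin_bigcup_measurable => //.
Qed.

(** An event on the first n letters is a finite disjoint union of cylinders. *)
Lemma prob_prefix_set n (p : pred (seq B)) :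
  P [set y | p (mkseq (code y) n)] =
  (\sum_(w : n.-tuple B) cyl_prob w * (p w)%:R)%:E.
Proof.
rewrite prefix_setE measure_bigcup_fintype//; last first.
  move=> v w y; rewrite /F; case: ifP => // _; case: ifP => // _.
  rewrite /code_cylinder /= !size_tuple => yv yw; apply/val_inj.
  by rewrite /= -yv.
rewrite -sumEFin; apply: eq_bigr => w _; rewrite /F; case: ifP => _.
  by rewrite mulr1; exact: cyl_probE.
by rewrite mulr0 measure0.
Qed.

Lemma cyl_prob_word_law : word_law cyl_prob.
Proof.
split=> [w||w]; first exact: fine_ge0.
  by rewrite /cyl_prob cylinder_nil probability_setT.
(* Read the cylinder as an event on one more letter, so that the sum over that letter appears. *)
have wE : code_cylinder (O := O) code w =
    [set y | take (size w) (mkseq (code y) (size w).+1) == w].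
  by apply/seteqP; split=> y; rewrite /code_cylinder /= take_mkseq// => /eqP.
rewrite -[RHS]/(fine _) wE (prob_prefix_set _ (fun v => take (size w) v == w)) /=.
rewrite (sum_tuple_rcons _ (fun v => cyl_prob v * (take (size w) v == w)%:R)).
rewrite -(sum_tuple_pred1 (fun u => \sum_a cyl_prob (rcons u a)) (erefl (size w))).
apply: eq_bigr => u _; rewrite mulr_suml; apply: eq_bigr => a _.
by rewrite -(cats1 u) (take_size_cat _ (size_tuple u)).
Qed.

Lemma cyl_prob_stationary (sh : Y -> Y) :
  (forall y n, code (sh y) n = code y n.+1) ->
  (forall C : set (g_sigma_algebraType O), measurable C -> P (sh @^-1` C) = P C) ->
  stationary cyl_prob.
Proof.
move=> shE Psh w.
rewrite {2}/cyl_prob -Psh; last exact: (measurable_code_cylinder cyl_open).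
have -> : sh @^-1` code_cylinder (O := O) code w =
    [set y | behead (mkseq (code y) (size w).+1) == w].
  have E y : mkseq (code (sh y)) (size w) = behead (mkseq (code y) (size w).+1).
    apply: (@eq_from_nth _ (code y 0%N)); rewrite ?size_behead ?size_mkseq// => i lt_i.
    by rewrite nth_behead !nth_mkseq// shE.
  apply/seteqP; split=> y.
    move=> yw; change (behead (mkseq (code y) (size w).+1) == w).
    by rewrite -E; exact/eqP.
  change (behead (mkseq (code y) (size w).+1) == w -> mkseq (code (sh y)) (size w) = w).
  by rewrite E => /eqP.
rewrite (prob_prefix_set _ (fun v => behead v == w)) /=.
rewrite (sum_tuple_cons _ (fun v => cyl_prob v * (behead v == w)%:R)).
by apply: eq_bigr => a _; rewrite (sum_tuple_pred1 (fun u => cyl_prob (a :: u))).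
Qed.

End cylinder_probabilities.

Section invariant_measures.
Variables (R : realType) (S : finType) (s0 : S) (A : rel S).
Local Notation X := (config s0).
Local Notation cyl := (code_cylinder (O := @open X) id).
Local Notation pcyl := (code_cylinder (O := @open (X * X)%type) (@pair_code S s0)).
Local Notation law mu := (cyl_prob (O := @open X) id mu).

Lemma measurable_sft : measurable (sft A : set (borel X)).
Proof.
pose p n v := A (nth s0 v n) (nth s0 v n.+1).
have pE (x : X) n : p n (mkseq x n.+2) = A (x n) (x n.+1).
  by rewrite /p !nth_mkseq.
rewrite (_ : sft A = \bigcap_n [set x : X | p n (mkseq x n.+2)]).
  apply: bigcapT_measurable => n.
  exact: (measurable_prefix_set (@config_cyl_open S s0) n.+2 (p n)).
apply/seteqP; split=> [x Ax n _|x Ax n]; last by rewrite -pE; exact: (Ax n I).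
by change (p n (mkseq x n.+2)); rewrite pE; exact: Ax.
Qed.

Variable mu : probability (borel X) R.
Hypothesis muA : invariant_on_sft A mu.

Lemma law_word_law : word_law (law mu).
Proof. exact: (cyl_prob_word_law (@config_cyl_open S s0)). Qed.

Lemma law_stationary : stationary (law mu).
Proof.
case: muA => _; apply: (@cyl_prob_stationary R S X (@open X) id
  (@config_cyl_open S s0) mu (@Defs.shift S s0)).
by [].
Qed.

(** [cylinder A w] is cut down to the subshift while the coded cylinder is not; the full mass of
    [sft A] makes the difference null. *)
Lemma law_cylinder n (w : n.-tuple S) : fine (mu (cylinder A w)) = law mu w.
Proof.
case: muA => muA1 _.
rewrite /cyl_prob -(full_measure_setI measurable_sft
  (measurable_code_cylinder (@config_cyl_open S s0) w) muA1).
congr (fine (mu _)); apply/seteqP; split=> x [Ax xw]; split => //.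
  apply: (@eq_from_nth _ s0); rewrite ?size_mkseq// size_tuple => i lt_i.
  by rewrite nth_mkseq// -(tnth_nth s0 w (Ordinal lt_i)) -xw.
move=> i; rewrite (tnth_nth s0); move: xw; rewrite /code_cylinder /= => <-.
by rewrite size_tuple nth_mkseq.
Qed.

Lemma entropyE : entropy A mu = limn (fun n => n%:R^-1 * block_entropy (law mu) n).
Proof.
congr (limn _); apply/funext => n; congr (_ * _); apply: eq_bigr => w _.
by rewrite law_cylinder.
Qed.

(** The cylinder of a word ending in a forbidden transition misses [sft A], a set of full
    measure. *)
Lemma law_admissible u a : u != [::] -> 0 < law mu (rcons u a) -> A (last s0 u) a.
Proof.
move=> u0 mu_gt0; apply: contraT => Aua; case: muA => muA1 _.
move: mu_gt0; rewrite /cyl_prob -(full_measure_setI measurable_sft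
  (measurable_code_cylinder (@config_cyl_open S s0) (rcons u a)) muA1).
rewrite (_ : _ `&` _ = set0) ?measure0 ?ltxx//.
apply/seteqP; split => // x [Ax]; rewrite /code_cylinder /= => xw.
case/lastP: u u0 Aua xw => // v b _; rewrite last_rcons !size_rcons => /negP Aba xw.
apply: Aba; have := Ax (size v).
have <- : nth s0 (rcons (rcons v b) a) (size v) = b.
  by rewrite !nth_rcons size_rcons ltnSn ltnn eqxx.
have {2}<- : nth s0 (rcons (rcons v b) a) (size v).+1 = a.
  by rewrite nth_rcons size_rcons ltnn eqxx.
by rewrite -xw !nth_mkseq.
Qed.

End invariant_measures.

Section transport.
Variables (R : realType) (B B' : finType) (Y Y' : pointedType).
Variables (O : set (set Y)) (O' : set (set Y')).
Variables (code : Y -> nat -> B) (code' : Y' -> nat -> B').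
Hypothesis cyl_open : forall w, O (code_cylinder (O := O) code w).
Hypothesis cyl_open' : forall w, O' (code_cylinder (O := O') code' w).
Hypothesis cyl_base' : forall U y, O' U -> U y ->
  exists n, code_cylinder (O := O') code' (mkseq (code' y) n) `<=` U.
Variable P : probability (g_sigma_algebraType O) R.
Variable Q : probability (g_sigma_algebraType O') R.
Variables (h : Y -> Y') (N : seq B' -> nat) (p : seq B' -> pred (seq B)).
Hypothesis hE : forall w y,
  (mkseq (code' (h y)) (size w) == w) = p w (mkseq (code y) (N w)).
Hypothesis QE : forall w, cyl_prob (O := O') code' Q w =
  \sum_(v : (N w).-tuple B) cyl_prob (O := O) code P v * (p w v)%:R.

Let preim w : h @^-1` code_cylinder (O := O') code' w =
  [set y | p w (mkseq (code y) (N w))].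
Proof.
by apply/seteqP; split=> y;
   change (mkseq (code' (h y)) (size w) = w -> p w (mkseq (code y) (N w))) ||
   change (p w (mkseq (code y) (N w)) -> mkseq (code' (h y)) (size w) = w);
   rewrite -hE => /eqP.
Qed.

Let mh : measurable_fun setT (h : g_sigma_algebraType O -> g_sigma_algebraType O').
Proof.
apply: (measurable_to_borel cyl_open' cyl_base') => w; rewrite preim.
exact: measurable_prefix_set.
Qed.

(** Preimages of cylinders under [h] are events on finitely many letters, so [h] is measurable and
    its image measure is determined by [QE]. Serves for both projections and for the shift of
    pairs. *)
Lemma transport (C : set (g_sigma_algebraType O')) : measurable C ->
  measurable (h @^-1` C : set (g_sigma_algebraType O)) /\ P (h @^-1` C) = Q C.
Proof.
move=> mC; split; first by rewrite -[X in measurable X]setTI; exact: mh.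
have [Q' Q'E] := pushforward_probability P mh.
rewrite -[LHS]Q'E; apply: (probability_unique cyl_open' cyl_base') mC => w.
by rewrite Q'E preim (prob_prefix_set cyl_open) (cyl_probE cyl_open') QE.
Qed.

End transport.

(** * From the stationary coupling to the distance *)

Section joining_bound.
Variables (R : realType) (S : finType) (s0 : S) (A : rel S).
Local Notation X := (config s0).
Local Notation law mu := (cyl_prob (O := @open X) id mu).
Variables (lambda : R) (r : S -> R).
Hypotheses (lambda0 : 0 < lambda) (r0 : forall a, 0 < r a).
Hypothesis rE : forall a, \sum_b (A a b)%:R * r b = lambda * r a.
Local Notation T := (parry_matrix A lambda r).
Variable m : probability (borel X) R.
Hypothesis mme_m : is_mme A m.

(** Maximal entropy is all that is assumed of [m]; the Parry transitions come from the equality case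
    [full_entropy_markov]. *)
Lemma mme_markov v b : v != [::] ->
  law m (rcons v b) = law m v * T (last s0 v) b.
Proof.
case: mme_m => mA hm; apply: (full_entropy_markov (A := A)) => //.
- exact: law_word_law.
- exact: (law_stationary mA).
- exact: (law_admissible mA).
- by rewrite -(entropyE mA) hm (htopE s0 lambda0 r0 rE).
Qed.

Variable mu : probability (borel X) R.
Hypothesis muA : invariant_on_sft A mu.

(** The measure with cylinder probabilities [z] is a joining: marginals and invariance are checked
    on cylinders through [transport]. *)
Lemma joining_of_law (z : seq (S * S) -> R) : word_law z -> stationary z ->
  (forall n (phi : seq S -> R), \sum_(w : n.-tuple (S * S)%type) z w * phi (unzip1 w) =
        \sum_(u : n.-tuple S) law mu u * phi u) ->
  (forall n (phi : seq S -> R), \sum_(w : n.-tuple (S * S)%type) z w * phi (unzip2 w) =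
        \sum_(v : n.-tuple S) law m v * phi v) ->
  (dbar A mu m <= (\sum_p z [:: p] * (p.1 != p.2)%:R)%:E)%E.
Proof.
move=> lz sz z1 z2; case: mme_m => mA _.
have [theta thetaE] := word_law_measure (decode := fun h : nat -> S * S =>
    ((fun n => (h n).1, fun n => (h n).2) : X * X)) (s0, s0) lz
  (@pair_cyl_open S s0) (@pair_cyl_base S s0)
  (fun h n => esym (surjective_pairing (h n))).
have lawz : cyl_prob (O := @open (X * X)%type) (@pair_code S s0) theta =1 z.
  by move=> w; rewrite /cyl_prob thetaE.
have mpre n (p : pred (seq (S * S))) := measurable_prefix_set (@pair_cyl_open S s0) n p.
have ppre n (p : pred (seq (S * S))) : theta [set y | p (mkseq (pair_code y) n)] =
    (\sum_(w : n.-tuple (S * S)%type) z w * (p w)%:R)%:E.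
  by rewrite (prob_prefix_set (@pair_cyl_open S s0)); under eq_bigr do rewrite lawz.
have fstE (C : set (borel X)) : measurable C ->
    measurable (fst @^-1` C : set (borel (X * X)%type)) /\ theta (fst @^-1` C) = mu C.
  apply: (@transport R _ _ _ _ _ _ _ _ (@pair_cyl_open S s0)
    (@config_cyl_open S s0) (@config_cyl_base S s0) theta mu fst size
    (fun w v => unzip1 v == w)) => [w z'|w].
    by rewrite /unzip1 /mkseq -map_comp.
  under eq_bigr do rewrite lawz.
  by rewrite (z1 _ (fun v => (v == w)%:R)) sum_tuple_pred1.
have sndE (C : set (borel X)) : measurable C ->
    measurable (snd @^-1` C : set (borel (X * X)%type)) /\ theta (snd @^-1` C) = m C.
  apply: (@transport R _ _ _ _ _ _ _ _ (@pair_cyl_open S s0)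
    (@config_cyl_open S s0) (@config_cyl_base S s0) theta m snd size
    (fun w v => unzip2 v == w)) => [w z'|w].
    by rewrite /unzip2 /mkseq -map_comp.
  under eq_bigr do rewrite lawz.
  by rewrite (z2 _ (fun v => (v == w)%:R)) sum_tuple_pred1.
have shE (C : set (borel (X * X)%type)) : measurable C -> theta (@shift2 S s0 @^-1` C) = theta C.
  move=> mC; apply: (proj2 (@transport R _ _ _ _ _ _ _ _ (@pair_cyl_open S s0)
    (@pair_cyl_open S s0) (@pair_cyl_base S s0) theta theta (@shift2 S s0)
    (fun w => (size w).+1) (fun w v => behead v == w) _ _ _ mC)) => [w y|w].
    congr (_ == w); apply: (@eq_from_nth _ (s0, s0)).
      by rewrite size_behead !size_mkseq.
    by rewrite size_mkseq => i lt_i; rewrite nth_behead !nth_mkseq.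
  under eq_bigr do rewrite lawz.
  rewrite lawz (sum_tuple_cons _ (fun v => z v * (behead v == w)%:R)) -sz.
  by apply: eq_bigr => a _; rewrite (sum_tuple_pred1 (fun u => z (a :: u))).
have [msft1 sft1] := fstE _ (measurable_sft A).
have [msft2 sft2] := sndE _ (measurable_sft A).
have sft12 : sft A `*` sft A = fst @^-1` sft A `&` snd @^-1` sft A :> set (X * X) by [].
apply: (@le_trans _ _ (theta [set y : X * X | [/\ sft A y.1, sft A y.2 & y.1 0%N <> y.2 0%N]])).
  apply: ereal_inf_lbound; exists theta => //; split => //.
  - rewrite sft12 full_measure_setI//; first by rewrite sft2; case: mA.
    by rewrite sft1; case: muA.
  - by move=> C /fstE[].
  - by move=> C /sndE[].
(* Mismatch of the first letters as an event on words of length 1, where the default of [head] is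
   never read. *)
pose p1 (w : seq (S * S)) := (head (s0, s0) w).1 != (head (s0, s0) w).2.
rewrite (_ : [set y | _] = (sft A `*` sft A) `&` [set y | p1 (mkseq (pair_code y) 1)]); last first.
  apply/seteqP; split=> [y [? ? /eqP ?]|y [[? ?] /eqP ?]]; split => //; split.
have msft : measurable (sft A `*` sft A : set (borel (X * X)%type)).
  by rewrite sft12; exact: measurableI.
have thetasft : theta (sft A `*` sft A) = 1%E.
  rewrite sft12 full_measure_setI//; first by rewrite sft2; case: mA.
  by rewrite sft1; case: muA.
rewrite full_measure_setI// ppre (sum_tuple_cons _ (fun w => z w * (p1 w)%:R)) lee_fin.
by apply: ler_sum => x _; rewrite (sum_tuple0 (fun w => z (x :: w) * (p1 (x :: w))%:R)).
Qed.

(** Here delta is the square root of the entropy gap. The resulting constant [k / q] is smaller than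
    the announced one. *)
Lemma dbar_le (k : nat) (q : R) : 0 < q -> (forall a b, q <= mxpow T k a b) ->
  (dbar A mu m <= (k%:R * Num.sqrt (htop R s0 A - entropy A mu) / q)%:E)%E.
Proof.
move=> q0 qT; case: (mme_m) => mA _.
have T0 := parry_matrix_ge0 A lambda0 r0.
have T1 := sum_parry_matrix lambda0 r0 rE.
have tvle n : \sum_(u : n.+1.-tuple S)
    law mu u * tv (cond_law s0 T (law mu) u) (T (last s0 u)) <=
    Num.sqrt (htop R s0 A - entropy A mu).
  apply: le_trans (mean_tv_step_le lambda0 r0 rE (law_word_law mu)
    (law_stationary muA) (law_admissible muA) n) _.
  rewrite ler_wsqrtr// (htopE s0 lambda0 r0 rE) (entropyE muA) lerD2l lerN2.
  exact: limn_block_entropy_le (law_word_law mu) (law_stationary muA).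
have [z [lz sz z1 z2 zq]] := stationary_coupling T0 T1 (law_word_law mu)
  (law_stationary muA) (law_word_law m) (law_stationary mA) mme_markov q0 qT tvle.
by apply: le_trans (joining_of_law lz sz z1 z2) _; rewrite lee_fin.
Qed.

(** [T] is [A / lambda] conjugated by the diagonal matrix of [r]; this carries positivity of powers
    of [A] over to [T]. *)
Lemma mxpow_parry k a b :
  mxpow T k a b = mxpow (fun a b => (A a b)%:R) k a b * r b / (lambda ^+ k * r a).
Proof.
elim: k a => [|k IHk] a.
  rewrite !mxpow0 expr0 mul1r; case: eqVneq => [->|_]; last by rewrite !mul0r.
  by rewrite mul1r divff ?gt_eqF.
rewrite !mxpowS !mulr_suml; apply: eq_bigr => c _; rewrite IHk /parry_matrix exprS.
by field; rewrite !gt_eqF ?exprn_gt0.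
Qed.

End joining_bound.

Theorem theorem1 (R : realType) (S : finType) (s0 : S) (A : rel S)
    (mixA : mixing A)
    (m : probability (borel (config s0)) R) (mme_m : is_mme A m) :
  (exists2 C : R, 0 < C &
     forall mu : probability (borel (config s0)) R, invariant_on_sft A mu ->
       (dbar A mu m <= (C * Num.sqrt (htop R s0 A - entropy A mu))%:E)%E)
  /\
  (forall (lambda : R) (l r : S -> R), perron_data A lambda l r ->
   let T := parry_matrix A lambda r in
   forall (k : nat) (q : R), (0 < k)%N ->
     (forall a b, 0 < mxpow T k a b) ->
     0 < q -> (forall a b, q <= mxpow T k a b) ->
     let C : R := Num.sqrt 2 * k%:R `^ (3 / 2) / q in
     forall mu : probability (borel (config s0)) R, invariant_on_sft A mu ->
       (dbar A mu m <= (C * Num.sqrt (htop R s0 A - entropy A mu))%:E)%E).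
Proof.
split.
  case: mixA => n n0 An.
  pose M a b : R := (A a b)%:R.
  have Mn a b : 0 < mxpow M n a b by rewrite mxpow_natr ltr0n.
  have [lambda [r [lambda0 r0 rE]]] :=
    perron_eigenvector s0 (fun a b => ler0n R (A a b)) n0 Mn.
  (* A positive lower bound for the finitely many entries of [T^n], positive as those of [A^n]
     are. *)
  have [q q0 qT] : exists2 q, 0 < q &
      forall ab : S * S, q <= mxpow (parry_matrix A lambda r) n ab.1 ab.2.
    apply: finite_pos_lbound => -[a b] /=.
    by rewrite mxpow_parry// divr_gt0 ?mulr_gt0 ?exprn_gt0.
  exists (n%:R / q) => [|mu muA]; first by rewrite divr_gt0 ?ltr0n.
  rewrite mulrAC.
  exact: (dbar_le lambda0 r0 rE mme_m muA q0 (fun a b => qT (a, b))).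
move=> lambda l r [lambda0 [_ r0] _ rE _] T k q k0 _ q0 qT C mu muA.
apply: le_trans (dbar_le lambda0 r0 rE mme_m muA q0 qT) _.
rewrite lee_fin mulrAC ler_wpM2r ?sqrtr_ge0// /C ler_wpM2r ?invr_ge0 ?(ltW q0)//.
(* As [k >= 1], the constant [k / q] is at most [sqrt 2 * k^(3/2) / q]. *)
have k1 : (1 : R) <= k%:R by rewrite ler1n.
have s1 : (1 : R) <= Num.sqrt 2 by rewrite -{1}sqrtr1 ler_wsqrtr// ler1n.
apply: (@le_trans _ _ (1 * k%:R `^ 1)).
  by rewrite mul1r powRr1// ler0n.
apply: ler_pM; rewrite ?powR_ge0//.
by apply: ler_powR => //; lra.
Qed.
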